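(* Let $R$ be an arbitrary ring and let $D_A:\mathrm{fp}(R\text{-}\mathrm{Mod},\mathrm{Ab})\to(\mathrm{mod}\text{-}R,\mathrm{Ab})^{\mathrm{op}}$ be the Auslander-Gruson-Jensen functor. Then there is an equivalence of categories $$\frac{\mathrm{fp}(R\text{-}\mathrm{Mod},\mathrm{Ab})}{\{F:D_AF=0\}}\simeq(\mathrm{mod}\text{-}R,\mathrm{Ab})^{\mathrm{op}},$$ where the left-hand side is the Serre quotient of $\mathrm{fp}(R\text{-}\mathrm{Mod},\mathrm{Ab})$ by the Serre subcategory of those $F$ with $D_AF=0$.
   Context: All categories and functors are additive. $R\text{-}\mathrm{Mod}$ is the category of left $R$-modules and $\mathrm{mod}\text{-}R$ is the category of finitely presented right $R$-modules. $(X,-)$ denotes the representable (Hom) functor and $(F,G)$ denotes the group of natural transformations $F\to G$; $\otimes=\otimes_R$. $\mathrm{fp}(R\text{-}\mathrm{Mod},\mathrm{Ab})$ is the (abelian) category of finitely presented functors, i.e. additive functors $F:R\text{-}\mathrm{Mod}\to\mathrm{Ab}$ for which there is an exact sequence $(Y,-)\to(X,-)\to F\to0$ with $X,Y\in R\text{-}\mathrm{Mod}$. $(\mathrm{mod}\text{-}R,\mathrm{Ab})$ is the (abelian) category of all additive functors $\mathrm{mod}\text{-}R\to\mathrm{Ab}$. The functor $D_A$ is defined by $(D_AF)M=(F,M\otimes-)$ for $F\in\mathrm{fp}(R\text{-}\mathrm{Mod},\mathrm{Ab})$ and $M\in\mathrm{mod}\text{-}R$, where $M\otimes-:R\text{-}\mathrm{Mod}\to\mathrm{Ab}$.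 *)

(* Defs.v *)
From HB Require Import structures.
From mathcomp Require Import all_boot all_algebra generic_quotient.
From mathcomp Require Import boolp.

Set Implicit Arguments.
Unset Strict Implicit.
Unset Printing Implicit Defensive.

Import GRing.Theory.
Local Open Scope ring_scope.
Local Open Scope quotient_scope.

Record category := Category {
  obj :> Type;
  hom : obj -> obj -> Type;
  idm : forall x, hom x x;
  comp : forall x y z, hom y z -> hom x y -> hom x z;
  comp1m : forall x y (f : hom x y), comp (idm y) f = f;
  compm1 : forall x y (f : hom x y), comp f (idm x) = f;
  compA : forall w x y z (h : hom y z) (g : hom x y) (f : hom w x),
    comp h (comp g f) = comp (comp h g) f }.

Arguments hom {_} _ _.
Arguments idm {_} _.
Arguments comp {_ _ _ _} _ _.

(* The homs are not packed as a zmodType: homs of functor categories live in a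
   larger universe than the carriers of modules and abelian groups, whereas
   zmodType lives at one fixed universe level. *)
Record preadditive := Preadditive {
  pcat :> category;
  addm : forall x y : pcat, hom x y -> hom x y -> hom x y;
  zerom : forall x y : pcat, hom x y;
  oppm : forall x y : pcat, hom x y -> hom x y;
  addmA : forall x y (f g h : @hom pcat x y),
    addm f (addm g h) = addm (addm f g) h;
  addmC : forall x y (f g : @hom pcat x y), addm f g = addm g f;
  add0m : forall x y (f : @hom pcat x y), addm (zerom x y) f = f;
  addNm : forall x y (f : @hom pcat x y), addm (oppm f) f = zerom x y;
  compDl : forall x y z (f g : @hom pcat y z) (h : @hom pcat x y),
    comp (addm f g) h = addm (comp f h) (comp g h);
  compDr : forall x y z (h : @hom pcat y z) (f g : @hom pcat x y),
    comp h (addm f g) = addm (comp h f) (comp h g) }.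

Arguments addm {_ _ _} _ _.
Arguments zerom {_} _ _.
Arguments oppm {_ _ _} _.

Record functor (C D : category) := Functor {
  fobj :> C -> D;
  fmap : forall x y : C, hom x y -> hom (fobj x) (fobj y);
  fmap1 : forall x, fmap (idm x) = idm (fobj x);
  fmapM : forall x y z (g : @hom C y z) (f : @hom C x y),
    fmap (comp g f) = comp (fmap g) (fmap f) }.

Arguments fmap {_ _} _ {_ _} _.

Record afunctor (C D : preadditive) := AFunctor {
  afun :> functor C D;
  fmapD : forall (x y : C) (f g : hom x y),
    fmap afun (addm f g) = addm (fmap afun f) (fmap afun g) }.

Lemma sig_ext (T : Type) (P : T -> Prop) (x y : {z | P z}) :
  sval x = sval y -> x = y.
Proof.
case: x y => x Px [y Py] /= xy; case: _ / xy Py => Py.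
by rewrite (Prop_irrelevance Px Py).
Qed.

Record nattrans (C D : category) (F G : functor C D) := NatTrans {
  ntc :> forall x : C, hom (F x) (G x);
  ntcP : forall (x y : C) (f : hom x y),
    comp (fmap G f) (ntc x) = comp (ntc y) (fmap F f) }.

Lemma nattrans_ext (C D : category) (F G : functor C D) (a b : nattrans F G) :
  (forall x, a x = b x) -> a = b.
Proof.
case: a b => a aP [b bP] /= ab.
have {}ab : a = b by apply: functional_extensionality_dep.
by case: _ / ab bP => bP; congr NatTrans; apply: Prop_irrelevance.
Qed.

Definition id_functor (C : category) : functor C C :=
  @Functor C C id (fun _ _ f => f) (fun _ => erefl) (fun _ _ _ _ _ => erefl).

Section CompFunctor.
Variables (C D E : category) (G : functor D E) (F : functor C D).

Lemma comp_functor1 (x : C) : fmap G (fmap F (idm x)) = idm (G (F x)).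
Proof. by rewrite !fmap1. Qed.

Lemma comp_functorM (x y z : C) (g : hom y z) (f : hom x y) :
  fmap G (fmap F (comp g f)) = comp (fmap G (fmap F g)) (fmap G (fmap F f)).
Proof. by rewrite !fmapM. Qed.

Definition comp_functor : functor C E :=
  @Functor C E (fun x => G (F x)) (fun _ _ f => fmap G (fmap F f))
    comp_functor1 comp_functorM.
End CompFunctor.

Definition is_iso (C : category) (x y : C) (f : hom x y) : Prop :=
  exists g : hom y x, comp g f = idm x /\ comp f g = idm y.

Definition nat_isomorphic (C D : category) (F G : functor C D) : Prop :=
  exists a : nattrans F G, forall x, is_iso (a x).

Definition equivalent (C D : category) : Prop :=
  exists (F : functor C D) (G : functor D C),
    nat_isomorphic (comp_functor G F) (id_functor C) /\
    nat_isomorphic (comp_functor F G) (id_functor D).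

Definition op_category (C : category) : category :=
  @Category C (fun x y => hom y x) (fun x => idm x) (fun _ _ _ g f => comp f g)
    (fun _ _ f => compm1 f) (fun _ _ f => comp1m f)
    (fun _ _ _ _ h g f => esym (compA f g h)).

Definition op (C : preadditive) : preadditive :=
  @Preadditive (op_category C)
    (fun x y f g => @addm C y x f g) (fun x y => @zerom C y x)
    (fun x y f => @oppm C y x f)
    (fun _ _ f g h => addmA f g h) (fun _ _ f g => addmC f g)
    (fun _ _ f => add0m f) (fun _ _ f => addNm f)
    (fun _ _ _ f g h => compDr h f g) (fun _ _ _ h f g => compDl f g h).

Section FullSubcategory.
Variables (C : preadditive) (P : C -> Prop).

Definition full_subcategory : category :=
  @Category {x : C | P x} (fun x y => hom (sval x) (sval y))
    (fun x => idm (sval x)) (fun _ _ _ g f => comp g f)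
    (fun _ _ f => comp1m f) (fun _ _ f => compm1 f)
    (fun _ _ _ _ h g f => compA h g f).

Definition full_sub : preadditive :=
  @Preadditive full_subcategory
    (fun x y f g => @addm C (sval x) (sval y) f g)
    (fun x y => @zerom C (sval x) (sval y))
    (fun x y f => @oppm C (sval x) (sval y) f)
    (fun _ _ f g h => addmA f g h) (fun _ _ f g => addmC f g)
    (fun _ _ f => add0m f) (fun _ _ f => addNm f)
    (fun _ _ _ f g h => compDl f g h) (fun _ _ _ h f g => compDr h f g).
End FullSubcategory.

Section PreadditiveTheory.
Variable C : preadditive.
Implicit Types x y z : C.

Lemma addm0 x y (f : hom x y) : addm f (zerom x y) = f.
Proof. by rewrite addmC add0m. Qed.

Lemma addmI x y (f g h : hom x y) : addm f g = addm f h -> g = h.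
Proof.
by move=> /(congr1 (addm (oppm f))); rewrite !addmA !addNm !add0m.
Qed.

Lemma addm_idem x y (f : hom x y) : addm f f = f -> f = zerom x y.
Proof. by move=> ff; apply: (@addmI x y f); rewrite addm0. Qed.

Lemma comp0m x y z (f : hom x y) : comp (zerom y z) f = zerom x z.
Proof. by apply: addm_idem; rewrite -compDl add0m. Qed.

Lemma compm0 x y z (f : hom y z) : comp f (zerom x y) = zerom x z.
Proof. by apply: addm_idem; rewrite -compDr add0m. Qed.

Lemma oppmP x y (f g : hom x y) : addm f g = zerom x y -> f = oppm g.
Proof.
by move=> fg; apply: (@addmI x y g); rewrite addmC fg addmC addNm.
Qed.

Lemma compNm x y z (f : hom y z) (g : hom x y) :
  comp (oppm f) g = oppm (comp f g).
Proof. by apply: oppmP; rewrite -compDl addNm comp0m. Qed.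

Lemma compmN x y z (f : hom y z) (g : hom x y) :
  comp f (oppm g) = oppm (comp f g).
Proof. by apply: oppmP; rewrite -compDr addNm compm0. Qed.

End PreadditiveTheory.

Section FunctorCategory.
Variables C D : preadditive.
Implicit Types F G H K : afunctor C D.

Lemma id_nat_subproof F (x y : C) (f : hom x y) :
  comp (fmap F f) (idm (F x)) = comp (idm (F y)) (fmap F f).
Proof. by rewrite compm1 comp1m. Qed.

Definition id_nat F : nattrans F F := NatTrans (@id_nat_subproof F).

Lemma comp_nat_subproof F G H (b : nattrans G H) (a : nattrans F G)
    (x y : C) (f : hom x y) :
  comp (fmap H f) (comp (b x) (a x)) = comp (comp (b y) (a y)) (fmap F f).
Proof. by rewrite compA ntcP -compA ntcP compA. Qed.

Definition comp_nat F G H (b : nattrans G H) (a : nattrans F G) :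
  nattrans F H := NatTrans (comp_nat_subproof b a).

Lemma add_nat_subproof F G (a b : nattrans F G) (x y : C) (f : hom x y) :
  comp (fmap G f) (addm (a x) (b x)) = comp (addm (a y) (b y)) (fmap F f).
Proof. by rewrite compDr compDl !ntcP. Qed.

Definition add_nat F G (a b : nattrans F G) : nattrans F G :=
  NatTrans (add_nat_subproof a b).

Lemma zero_nat_subproof F G (x y : C) (f : hom x y) :
  comp (fmap G f) (zerom (F x) (G x)) = comp (zerom (F y) (G y)) (fmap F f).
Proof. by rewrite comp0m compm0. Qed.

Definition zero_nat F G : nattrans F G := NatTrans (@zero_nat_subproof F G).

Lemma opp_nat_subproof F G (a : nattrans F G) (x y : C) (f : hom x y) :
  comp (fmap G f) (oppm (a x)) = comp (oppm (a y)) (fmap F f).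
Proof. by rewrite compNm compmN ntcP. Qed.

Definition opp_nat F G (a : nattrans F G) : nattrans F G :=
  NatTrans (opp_nat_subproof a).

Lemma comp_nat1m F G (a : nattrans F G) : comp_nat (id_nat G) a = a.
Proof. by apply: nattrans_ext => x /=; rewrite comp1m. Qed.

Lemma comp_natm1 F G (a : nattrans F G) : comp_nat a (id_nat F) = a.
Proof. by apply: nattrans_ext => x /=; rewrite compm1. Qed.

Lemma comp_natA F G H K (c : nattrans H K) (b : nattrans G H)
    (a : nattrans F G) :
  comp_nat c (comp_nat b a) = comp_nat (comp_nat c b) a.
Proof. by apply: nattrans_ext => x /=; rewrite compA. Qed.

Lemma comp_natDl F G H (a b : nattrans G H) (c : nattrans F G) :
  comp_nat (add_nat a b) c = add_nat (comp_nat a c) (comp_nat b c).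
Proof. by apply: nattrans_ext => x /=; rewrite compDl. Qed.

Lemma comp_natDr F G H (c : nattrans G H) (a b : nattrans F G) :
  comp_nat c (add_nat a b) = add_nat (comp_nat c a) (comp_nat c b).
Proof. by apply: nattrans_ext => x /=; rewrite compDr. Qed.

Definition functor_category : category :=
  @Category (afunctor C D) (fun F G => nattrans F G)
    id_nat comp_nat comp_nat1m comp_natm1 comp_natA.

Definition functors : preadditive.
Proof.
refine (@Preadditive functor_category add_nat zero_nat opp_nat _ _ _ _
  comp_natDl comp_natDr).
- by move=> F G a b c; apply: nattrans_ext => x /=; rewrite addmA.
- by move=> F G a b; apply: nattrans_ext => x /=; rewrite addmC.
- by move=> F G a; apply: nattrans_ext => x /=; rewrite add0m.
- by move=> F G a; apply: nattrans_ext => x /=; rewrite addNm.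
Defined.

End FunctorCategory.

Section Localization.
Variables (C : category) (W : forall x y : C, hom x y -> Prop).

(* Morphisms of C[W^-1] are formal composites of morphisms of C and formal
   inverses of morphisms in W, modulo lterm_eq. *)
Inductive lterm : C -> C -> Type :=
| LGen x y (f : hom x y) : lterm x y
| LInv x y (s : hom x y) (Ws : W s) : lterm y x
| LComp x y z (g : lterm y z) (f : lterm x y) : lterm x z.

Inductive lterm_eq : forall x y, lterm x y -> lterm x y -> Prop :=
| leqt_refl x y (f : lterm x y) : lterm_eq f f
| leqt_sym x y (f g : lterm x y) : lterm_eq f g -> lterm_eq g f
| leqt_trans x y (f g h : lterm x y) :
    lterm_eq f g -> lterm_eq g h -> lterm_eq f h
| leqt_comp x y z (g g' : lterm y z) (f f' : lterm x y) :
    lterm_eq g g' -> lterm_eq f f' -> lterm_eq (LComp g f) (LComp g' f')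
| leqt_1m x y (f : lterm x y) : lterm_eq (LComp (LGen (idm y)) f) f
| leqt_m1 x y (f : lterm x y) : lterm_eq (LComp f (LGen (idm x))) f
| leqt_A w x y z (h : lterm y z) (g : lterm x y) (f : lterm w x) :
    lterm_eq (LComp h (LComp g f)) (LComp (LComp h g) f)
| leqt_gen x y z (g : hom y z) (f : hom x y) :
    lterm_eq (LGen (comp g f)) (LComp (LGen g) (LGen f))
| leqt_Vm x y (s : hom x y) (Ws : W s) :
    lterm_eq (LComp (LInv Ws) (LGen s)) (LGen (idm x))
| leqt_mV x y (s : hom x y) (Ws : W s) :
    lterm_eq (LComp (LGen s) (LInv Ws)) (LGen (idm y)).

Definition lhom (x y : C) : Type :=
  {P : lterm x y -> Prop | exists f, P = lterm_eq f}.

Definition lclass x y (f : lterm x y) : lhom x y :=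
  exist _ (lterm_eq f) (ex_intro _ f erefl).

Definition lrepr x y (P : lhom x y) : lterm x y := projT1 (cid (svalP P)).

Lemma lreprK x y (P : lhom x y) : lclass (lrepr P) = P.
Proof. by rewrite /lrepr; case: cid => f fP; apply: sig_ext. Qed.

Lemma lclassE x y (f g : lterm x y) : lclass f = lclass g <-> lterm_eq f g.
Proof.
split=> [[fg]|fg]; first by rewrite fg; apply: leqt_refl.
apply: sig_ext => /=; apply: funext => h; apply: propext; split => H.
  exact: leqt_trans (leqt_sym fg) H.
exact: leqt_trans fg H.
Qed.

Lemma lrepr_class x y (f : lterm x y) : lterm_eq (lrepr (lclass f)) f.
Proof. by apply/lclassE; rewrite lreprK. Qed.

Definition lcomp x y z (g : lhom y z) (f : lhom x y) : lhom x z :=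
  lclass (LComp (lrepr g) (lrepr f)).

Definition localization : category.
Proof.
refine (@Category C lhom (fun x => lclass (LGen (idm x))) lcomp _ _ _).
- move=> x y f; rewrite -[RHS]lreprK; apply/lclassE.
  apply: leqt_trans (leqt_1m _).
  by apply: leqt_comp; [apply: lrepr_class|apply: leqt_refl].
- move=> x y f; rewrite -[RHS]lreprK; apply/lclassE.
  apply: leqt_trans (leqt_m1 _).
  by apply: leqt_comp; [apply: leqt_refl|apply: lrepr_class].
- move=> w x y z h g f; apply/lclassE.
  apply: leqt_trans (leqt_comp (leqt_refl _) (lrepr_class _)) _.
  apply: leqt_trans (leqt_A _ _ _) _.
  exact: leqt_comp (leqt_sym (lrepr_class _)) (leqt_refl _).
Defined.

End Localization.

Section SerreQuotient.
Variable C : preadditive.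

Definition is_zero_object (x : C) : Prop :=
  (forall (y : C) (f g : hom x y), f = g) /\
  (forall (y : C) (f g : hom y x), f = g).

Definition is_kernel (x y k : C) (f : hom x y) (i : hom k x) : Prop :=
  comp f i = zerom k y /\
  forall (w : C) (g : hom w x), comp f g = zerom w y ->
    exists! h : hom w k, comp i h = g.

Definition is_cokernel (x y c : C) (f : hom x y) (p : hom y c) : Prop :=
  comp p f = zerom x c /\
  forall (w : C) (g : hom y w), comp g f = zerom x w ->
    exists! h : hom c w, comp h p = g.

Definition serre_iso (S : C -> Prop) (x y : C) (f : hom x y) : Prop :=
  (exists (k : C) (i : hom k x), is_kernel f i /\ S k) /\
  (exists (c : C) (p : hom y c), is_cokernel f p /\ S c).

(* C/S is the localization of C at the morphisms with kernel and cokernel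
   in S; meant for C abelian and S a Serre subcategory. *)
Definition serre_quotient (S : C -> Prop) : category :=
  localization (serre_iso S).

End SerreQuotient.

Lemma additive_ext (A B : zmodType) (f g : {additive A -> B}) : f =1 g -> f = g.
Proof.
case: f g => f [[cf]] [g [[cg]]] /= /funext fg.
by case: _ / fg cg => cg; rewrite (Prop_irrelevance cf cg).
Qed.

Lemma additive_compE (A B C : zmodType) (g : {additive B -> C})
    (f : {additive A -> B}) x : (g \o f : {additive A -> C}) x = g (f x).
Proof. by []. Qed.

Definition Ab_category : category.
Proof.
refine (@Category zmodType (fun A B => {additive A -> B})
  (fun A => idfun) (fun A B C g f => g \o f) _ _ _).
- by move=> A B f; apply: additive_ext.
- by move=> A B f; apply: additive_ext.
- by move=> A B C D h g f; apply: additive_ext.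
Defined.

Definition Ab : preadditive.
Proof.
refine (@Preadditive Ab_category (fun A B (f g : {additive A -> B}) => f \+ g)
  (fun A B => \0) (fun A B (f : {additive A -> B}) => \- f) _ _ _ _ _ _).
- by move=> A B f g h; apply: additive_ext => x /=; rewrite addrA.
- by move=> A B f g; apply: additive_ext => x /=; rewrite addrC.
- by move=> A B f; apply: additive_ext => x /=; rewrite add0r.
- by move=> A B f; apply: additive_ext => x /=; rewrite addNr.
- by move=> A B C f g h; apply: additive_ext.
- by move=> A B C f g h; apply: additive_ext => x /=; rewrite raddfD.
Defined.

Lemma linear_ext (R : pzRingType) (M N : lmodType R) (f g : {linear M -> N}) :
  f =1 g -> f = g.
Proof.
case: f g => f [[af] [sf]] [g [[ag] [sg]]] /= /funext fg.
case: _ / fg ag sg => ag sg.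
by rewrite (Prop_irrelevance af ag) (Prop_irrelevance sf sg).
Qed.

(* Left R-modules; right R-modules are the modules over the converse ring
   R^c, i.e. the objects of Mod R^c. *)
Definition Mod_category (R : pzRingType) : category.
Proof.
refine (@Category (lmodType R) (fun M N => {linear M -> N})
  (fun M => idfun) (fun M N P g f => g \o f) _ _ _).
- by move=> A B f; apply: linear_ext.
- by move=> A B f; apply: linear_ext.
- by move=> A B C D h g f; apply: linear_ext.
Defined.

Definition Mod (R : pzRingType) : preadditive.
Proof.
refine (@Preadditive (Mod_category R)
  (fun M N (f g : {linear M -> N}) => f \+ g)
  (fun M N => \0) (fun M N (f : {linear M -> N}) => \- f) _ _ _ _ _ _).
- by move=> A B f g h; apply: linear_ext => x /=; rewrite addrA.
- by move=> A B f g; apply: linear_ext => x /=; rewrite addrC.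
- by move=> A B f; apply: linear_ext => x /=; rewrite add0r.
- by move=> A B f; apply: linear_ext => x /=; rewrite addNr.
- by move=> A B C f g h; apply: linear_ext.
- by move=> A B C f g h; apply: linear_ext => x /=; rewrite raddfD.
Defined.

Definition finitely_presented (R : pzRingType) (M : lmodType R) : Prop :=
  exists (n m : nat) (p : {linear 'rV[R]_n -> M})
         (q : {linear 'rV[R]_m -> 'rV[R]_n}),
    (forall y, exists x, p x = y) /\
    (forall x, p x = 0 <-> exists z, q z = x).

Definition fp_right_mod (R : pzRingType) : preadditive :=
  @full_sub (Mod R^c) (@finitely_presented R^c).

Section Tensor.
Variables (R : pzRingType) (M : lmodType R^c) (N : lmodType R).

(* A list stands for the sum of the m (x) n with (m, n) in it. Formal
   opposites are not needed: - (m (x) n) is (- m) (x) n. *)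
Inductive tens_eq : seq (M * N) -> seq (M * N) -> Prop :=
| tens_refl s : tens_eq s s
| tens_sym s t : tens_eq s t -> tens_eq t s
| tens_trans s t u : tens_eq s t -> tens_eq t u -> tens_eq s u
| tens_cat s s' t t' :
    tens_eq s s' -> tens_eq t t' -> tens_eq (s ++ t) (s' ++ t')
| tens_catC s t : tens_eq (s ++ t) (t ++ s)
| tens_0l n : tens_eq [:: (0, n)] [::]
| tens_Dl m m' n : tens_eq [:: (m + m', n)] [:: (m, n); (m', n)]
| tens_Dr m n n' : tens_eq [:: (m, n + n')] [:: (m, n); (m, n')]
| tens_bal (r : R) m n :
    tens_eq [:: ((r : R^c) *: m, n)] [:: (m, r *: n)].

Definition tens_eqb : rel (seq (M * N)) := fun s t => `[< tens_eq s t >].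

Lemma tens_eqb_equiv : equiv_class_of tens_eqb.
Proof.
split=> [s|s t|t s u].
- by apply/asboolP; apply: tens_refl.
- by apply/asboolP/asboolP; apply: tens_sym.
- by move=> /asboolP st /asboolP tu; apply/asboolP; apply: tens_trans st tu.
Qed.

Canonical tens_equiv := EquivRelPack tens_eqb_equiv.

Definition tensor : Type := {eq_quot tens_equiv}.
HB.instance Definition _ := Choice.on tensor.

Definition tpi (s : seq (M * N)) : tensor := \pi_{eq_quot tens_equiv} s.
Definition trepr (q : tensor) : seq (M * N) := repr q.

Lemma treprK q : tpi (trepr q) = q.
Proof. exact: reprK. Qed.

Lemma tpiP s t : tpi s = tpi t <-> tens_eq s t.
Proof.
split=> [/eqP|st]; first by rewrite /tpi eqmodE => /asboolP.
by apply/eqP; rewrite /tpi eqmodE; apply/asboolP.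
Qed.

Lemma trepr_pi s : tens_eq (trepr (tpi s)) s.
Proof. by apply/tpiP; rewrite treprK. Qed.

Definition tadd (q r : tensor) : tensor := tpi (trepr q ++ trepr r).
Definition topp (q : tensor) : tensor :=
  tpi [seq (- p.1, p.2) | p <- trepr q].

Lemma taddE s t : tadd (tpi s) (tpi t) = tpi (s ++ t).
Proof. by apply/tpiP; apply: tens_cat; apply: trepr_pi. Qed.

Lemma taddA : associative tadd.
Proof.
move=> a b c; rewrite -(treprK a) -(treprK b) -(treprK c).
by rewrite !taddE catA.
Qed.

Lemma taddC : commutative tadd.
Proof.
move=> a b; rewrite -(treprK a) -(treprK b) !taddE.
by apply/tpiP; apply: tens_catC.
Qed.

Lemma tadd0 : left_id (tpi [::]) tadd.
Proof. by move=> a; rewrite -(treprK a) taddE. Qed.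

Lemma taddN : left_inverse (tpi [::]) topp tadd.
Proof.
move=> a; rewrite -{2}(treprK a) /topp taddE; apply/tpiP.
elim: (trepr a) => [|[m n] s IH] /=; first exact: tens_refl.
set s' := map _ _ in IH *.
apply: (@tens_trans _ ([:: (- m, n); (m, n)] ++ (s' ++ s))).
  rewrite -(cat1s _ (s' ++ _)) -(cat1s _ s) (catA s').
  have -> : [:: (- m, n); (m, n)] ++ (s' ++ s)
    = [:: (- m, n)] ++ (([:: (m, n)] ++ s') ++ s) by [].
  apply: tens_cat; first exact: tens_refl.
  by apply: tens_cat; [apply: tens_catC|apply: tens_refl].
apply: (@tens_trans _ ([::] ++ [::])) => //; last exact: tens_refl.
apply: tens_cat => //.
apply: tens_trans (tens_sym (tens_Dl _ _ _)) _.
by rewrite addNr; apply: tens_0l.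
Qed.

HB.instance Definition _ :=
  GRing.isZmodule.Build tensor taddA taddC tadd0 taddN.

Definition pure (m : M) (n : N) : tensor := tpi [:: (m, n)].

Lemma tpiD s t : tpi (s ++ t) = tpi s + tpi t.
Proof. by rewrite -taddE. Qed.

Lemma tpiE s : tpi s = \sum_(p <- s) pure p.1 p.2.
Proof.
elim: s => [|[m n] s IH]; first by rewrite big_nil.
by rewrite big_cons -IH /= -cat1s tpiD.
Qed.

Lemma pureDl m m' n : pure (m + m') n = pure m n + pure m' n.
Proof. by rewrite /pure -tpiD; apply/tpiP; apply: tens_Dl. Qed.

Lemma pureDr m n n' : pure m (n + n') = pure m n + pure m n'.
Proof. by rewrite /pure -tpiD; apply/tpiP; apply: tens_Dr. Qed.

Lemma pure_bal (r : R) m n : pure ((r : R^c) *: m) n = pure m (r *: n).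
Proof. by apply/tpiP; apply: tens_bal. Qed.

Lemma tensor_ext (A : zmodType) (f g : {additive tensor -> A}) :
  (forall m n, f (pure m n) = g (pure m n)) -> f = g.
Proof.
move=> fg; apply: additive_ext => q; rewrite -(treprK q) tpiE !raddf_sum.
exact: eq_bigr.
Qed.

Definition balanced (A : zmodType) (b : M -> N -> A) : Prop :=
  [/\ forall m m' n, b (m + m') n = b m n + b m' n,
      forall m n n', b m (n + n') = b m n + b m n' &
      forall (r : R) m n, b ((r : R^c) *: m) n = b m (r *: n)].

Section Lift.
Variables (A : zmodType) (b : M -> N -> A).
Hypothesis bP : balanced b.

Definition tlift_fun (q : tensor) : A := \sum_(p <- trepr q) b p.1 p.2.

Lemma tlift_tpi s : tlift_fun (tpi s) = \sum_(p <- s) b p.1 p.2.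
Proof.
have [bDl bDr bb] := bP.
rewrite /tlift_fun; move: (trepr (tpi s)) (trepr_pi s) => s' ss'.
elim: s' s / ss' => //=.
- by move=> s1 s2 s3 _ -> _ ->.
- by move=> s1 s2 t t' _ e1 _ e2; rewrite !big_cat /= e1 e2.
- by move=> s1 t; rewrite !big_cat /= addrC.
- move=> n; rewrite big_nil big_seq1 /=.
  by apply: (addrI (b 0 n)); rewrite -bDl !addr0.
- by move=> m m' n; rewrite !big_cons !big_nil /= !addr0 bDl.
- by move=> m n n'; rewrite !big_cons !big_nil /= !addr0 bDr.
- by move=> r m n; rewrite !big_seq1 /= bb.
Qed.

Lemma tlift_subproof : zmod_morphism tlift_fun.
Proof.
have D q r : tlift_fun (q + r) = tlift_fun q + tlift_fun r.
  rewrite -(treprK q) -(treprK r) -tpiD !tlift_tpi big_cat //=.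
move=> q r; apply: (addIr (tlift_fun r)).
by rewrite -D subrK addrNK.
Qed.

HB.instance Definition _ :=
  GRing.isZmodMorphism.Build tensor A tlift_fun tlift_subproof.

Definition tlift : {additive tensor -> A} := tlift_fun.

Lemma tliftE m n : tlift (pure m n) = b m n.
Proof. by rewrite /tlift /= tlift_tpi big_seq1. Qed.

End Lift.

Lemma tensor_universal (A : zmodType) (b : M -> N -> A) :
  balanced b ->
  exists! f : {additive tensor -> A}, forall m n, f (pure m n) = b m n.
Proof.
move=> bP; exists (tlift bP); split=> [m n|g gE]; first exact: tliftE.
by apply: tensor_ext => m n; rewrite gE tliftE.
Qed.

End Tensor.

Section TensorMap.
Variable R : pzRingType.

Section Map.
Variables (M M' : lmodType R^c) (N N' : lmodType R).
Variables (f : {linear M -> M'}) (g : {linear N -> N'}).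

Lemma tmap_balanced : balanced (fun m n => pure (f m) (g n)).
Proof.
split=> [m m' n|m n n'|r m n]; rewrite ?raddfD.
- exact: pureDl.
- exact: pureDr.
- by rewrite !linearZ pure_bal.
Qed.

Definition tmap : {additive tensor M N -> tensor M' N'} := tlift tmap_balanced.

Lemma tmapE m n : tmap (pure m n) = pure (f m) (g n).
Proof. exact: tliftE. Qed.

End Map.

Lemma tmap1 (M : lmodType R^c) (N : lmodType R) :
  tmap idfun idfun = idfun :> {additive tensor M N -> tensor M N}.
Proof. by apply: tensor_ext => m n; rewrite tmapE. Qed.

Lemma tmapDl (M M' : lmodType R^c) (N N' : lmodType R)
    (f f' : {linear M -> M'}) (g : {linear N -> N'}) :
  tmap (f \+ f') g = tmap f g \+ tmap f' g
    :> {additive tensor M N -> tensor M' N'}.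
Proof. by apply: tensor_ext => m n; rewrite tmapE [RHS]/= !tmapE -pureDl. Qed.

Lemma tmapDr (M M' : lmodType R^c) (N N' : lmodType R)
    (f : {linear M -> M'}) (g g' : {linear N -> N'}) :
  tmap f (g \+ g') = tmap f g \+ tmap f g'
    :> {additive tensor M N -> tensor M' N'}.
Proof. by apply: tensor_ext => m n; rewrite tmapE [RHS]/= !tmapE -pureDr. Qed.

Lemma tmapC (M M' : lmodType R^c) (N N' : lmodType R)
    (f : {linear M -> M'}) (g : {linear N -> N'}) :
  tmap idfun g \o tmap f idfun = tmap f idfun \o tmap idfun g
    :> {additive tensor M N -> tensor M' N'}.
Proof. by apply: tensor_ext => m n; rewrite ?additive_compE !tmapE. Qed.

Lemma tmapMr (M : lmodType R^c) (N N' N'' : lmodType R)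
    (g' : {linear N' -> N''}) (g : {linear N -> N'}) :
  tmap idfun (g' \o g) = tmap idfun g' \o tmap idfun g
    :> {additive tensor M N -> tensor M N''}.
Proof. by apply: tensor_ext => m n; rewrite ?additive_compE !tmapE. Qed.

Lemma tmapMl (M M' M'' : lmodType R^c) (N : lmodType R)
    (f' : {linear M' -> M''}) (f : {linear M -> M'}) :
  tmap (f' \o f) idfun = tmap f' idfun \o tmap f idfun
    :> {additive tensor M N -> tensor M'' N}.
Proof. by apply: tensor_ext => m n; rewrite ?additive_compE !tmapE. Qed.

Definition tensor_functor (M : lmodType R^c) : afunctor (Mod R) Ab :=
  @AFunctor (Mod R) Ab (@Functor (Mod R) Ab
    (fun N : lmodType R => tensor M N : zmodType)
    (fun N N' (g : {linear N -> N'}) => tmap idfun g)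
    (fun N => tmap1 M N) (fun _ _ _ g' g => tmapMr M g' g))
    (fun _ _ g g' => tmapDr idfun g g').

Definition tensor_nat (M M' : lmodType R^c) (f : {linear M -> M'}) :
  nattrans (tensor_functor M) (tensor_functor M') :=
  @NatTrans (Mod R) Ab (tensor_functor M) (tensor_functor M')
    (fun N : lmodType R => tmap f idfun) (fun _ _ g => tmapC f g).

Lemma tensor_nat1 (M : lmodType R^c) :
  tensor_nat (idfun : {linear M -> M}) = id_nat (tensor_functor M).
Proof. by apply: nattrans_ext => N; apply: tmap1. Qed.

Lemma tensor_natM (M M' M'' : lmodType R^c)
    (f' : {linear M' -> M''}) (f : {linear M -> M'}) :
  tensor_nat (f' \o f) = comp_nat (tensor_nat f') (tensor_nat f).
Proof. by apply: nattrans_ext => N; apply: tmapMl. Qed.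

Lemma tensor_natD (M M' : lmodType R^c) (f g : {linear M -> M'}) :
  tensor_nat (f \+ g) = add_nat (tensor_nat f) (tensor_nat g).
Proof. by apply: nattrans_ext => N; apply: tmapDl. Qed.

End TensorMap.

Section HomGroup.
Variables (R : pzRingType) (X M : lmodType R).

Definition homgroup : Type := {linear X -> M}.
HB.instance Definition _ := gen_eqMixin homgroup.
HB.instance Definition _ := gen_choiceMixin homgroup.
HB.instance Definition _ := GRing.isZmodule.Build homgroup
  (@addmA (Mod R) X M) (@addmC (Mod R) X M)
  (@add0m (Mod R) X M) (@addNm (Mod R) X M).
End HomGroup.

Section Representable.
Variables (R : pzRingType) (X : lmodType R).

Section Map.
Variables (M N : lmodType R) (f : {linear M -> N}).

Definition postcomp (h : homgroup X M) : homgroup X N :=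
  @comp (Mod R) X M N f h.

Lemma postcomp_subproof : zmod_morphism postcomp.
Proof.
move=> g h; apply: linear_ext => x /=.
by rewrite raddfB.
Qed.

HB.instance Definition _ := GRing.isZmodMorphism.Build
  (homgroup X M) (homgroup X N) postcomp postcomp_subproof.
End Map.

Definition representable : afunctor (Mod R) Ab.
Proof.
unshelve refine (@AFunctor (Mod R) Ab (@Functor (Mod R) Ab
  (fun M : lmodType R => homgroup X M : zmodType)
  (fun M N (f : {linear M -> N}) =>
     (postcomp f : {additive homgroup X M -> homgroup X N})) _ _) _).
- by move=> M; apply: additive_ext => h; apply: linear_ext.
- by move=> M N P g f; apply: additive_ext => h; apply: linear_ext.
- by move=> M N f g; apply: additive_ext => h; apply: linear_ext.
Defined.

End Representable.

Section FpFunctors.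
Variable R : pzRingType.

Definition ev (F : afunctor (Mod R) Ab) (M : lmodType R) : zmodType := F M.
Definition evm (F : afunctor (Mod R) Ab) (M N : lmodType R)
  (f : {linear M -> N}) : {additive ev F M -> ev F N} := @fmap _ _ F M N f.
Definition evn (F G : afunctor (Mod R) Ab) (a : nattrans F G)
  (M : lmodType R) : {additive ev F M -> ev G M} := a M.

(* There is an exact sequence (Y,-) -> (X,-) -> F -> 0; exactness of functors
   is pointwise. *)
Definition fp_functor (F : afunctor (Mod R) Ab) : Prop :=
  exists (X Y : lmodType R)
         (q : nattrans (representable Y) (representable X))
         (p : nattrans (representable X) F),
    forall M : lmodType R,
      (forall y : ev F M, exists x, evn p M x = y) /\
      (forall x : ev (representable X) M,
         evn p M x = 0 <-> exists z, evn q M z = x).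

Definition fp_functors : preadditive :=
  @full_sub (functors (Mod R) Ab) fp_functor.

End FpFunctors.

(* The natural transformations F -> G form a type in a larger universe than
   the values of F and G. For F finitely presented this group is small: a
   natural transformation a is determined by its value a_X(x), where x is the
   image of id_X under a presentation (X,-) -> F. So (F, G) is represented by
   the subgroup of G X of all such values; see smallnatK and natsmallK. *)
Section SmallNat.
Variable R : pzRingType.
Implicit Types (F G H : afunctor (Mod R) Ab).

Definition generates F (X : lmodType R) (x : ev F X) : Prop :=
  forall (M : lmodType R) (y : ev F M), exists f : {linear X -> M},
    evm F f x = y.

Lemma fp_generated F : fp_functor F ->
  exists Xx : {X : lmodType R & ev F X}, generates (projT2 Xx).
Proof.
move=> [X [Y [q [p pP]]]].
exists (existT _ X (evn p X (idfun : {linear X -> X}))) => M y /=.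
have [/(_ y)[f fy] _] := pP M; exists f; rewrite -fy.
have /(congr1 (fun h : {additive homgroup X X -> ev F M} => h idfun)) :=
  @ntcP _ _ _ _ p X M f.
rewrite /= => ->; rewrite /evn /=; congr (_ _).
exact: linear_ext.
Qed.

Definition gen_obj (F : fp_functors R) : lmodType R :=
  projT1 (projT1 (cid (fp_generated (svalP F)))).

Definition gen_elt (F : fp_functors R) : ev (sval F) (gen_obj F) :=
  projT2 (projT1 (cid (fp_generated (svalP F)))).

Lemma gen_eltP (F : fp_functors R) : generates (gen_elt F).
Proof. by rewrite /gen_elt /gen_obj; case: cid. Qed.

Section Fix.
Variables (F : fp_functors R) (G : afunctor (Mod R) Ab).
Notation nat_FG := (nattrans (sval F) G).

Definition natvalue (a : nat_FG) : ev G (gen_obj F) :=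
  evn a (gen_obj F) (gen_elt F).

Lemma natvalue_inj : injective natvalue.
Proof.
move=> a b ab; apply: nattrans_ext => M; apply: additive_ext => y.
have [f <-] := gen_eltP y.
have E (c : nat_FG) : evn c M (evm (sval F) f (gen_elt F)) =
    evm G f (natvalue c).
  exact: (congr1 (fun h : {additive ev (sval F) (gen_obj F) -> ev G M} =>
    h (gen_elt F)) (esym (@ntcP _ _ _ _ c (gen_obj F) M f))).
by have := E a; rewrite ab -E.
Qed.

Definition is_natvalue : {pred ev G (gen_obj F)} :=
  fun y => `[< exists a : nat_FG, natvalue a = y >].

Lemma is_natvalue_closed : zmod_closed is_natvalue.
Proof.
split=> [|_ _ /asboolP[a <-] /asboolP[b <-]]; apply/asboolP.
  by exists (zero_nat _ _).
by exists (add_nat a (opp_nat b)).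
Qed.

HB.instance Definition _ :=
  GRing.isZmodClosed.Build _ is_natvalue is_natvalue_closed.

Record smallnat := SmallNat {
  smallval : ev G (gen_obj F);
  smallvalP : smallval \in is_natvalue }.

HB.instance Definition _ := [isSub for smallval].
HB.instance Definition _ := [Choice of smallnat by <:].
HB.instance Definition _ := [SubChoice_isSubZmodule of smallnat by <:].

Lemma natvalueP (a : nat_FG) : natvalue a \in is_natvalue.
Proof. by apply/asboolP; exists a. Qed.

Definition natsmall (a : nat_FG) : smallnat := SmallNat (natvalueP a).

Lemma smallnat_ex (y : smallnat) : exists a : nat_FG, natvalue a = smallval y.
Proof. by apply/asboolP; case: y. Qed.

Definition smallnat_nat (y : smallnat) : nat_FG := projT1 (cid (smallnat_ex y)).

Lemma smallnatK : cancel smallnat_nat natsmall.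
Proof.
by move=> y; rewrite /smallnat_nat; case: cid => a ay; apply: val_inj.
Qed.

Lemma natsmallK : cancel natsmall smallnat_nat.
Proof.
move=> a; apply: natvalue_inj.
exact: (congr1 smallval (smallnatK (natsmall a))).
Qed.

Lemma natsmallD (a b : nat_FG) :
  natsmall (add_nat a b) = natsmall a + natsmall b.
Proof. exact: val_inj. Qed.

Lemma smallnat_natD (y z : smallnat) :
  smallnat_nat (y + z) = add_nat (smallnat_nat y) (smallnat_nat z).
Proof.
by rewrite -(smallnatK y) -(smallnatK z) -natsmallD !natsmallK.
Qed.

End Fix.

Lemma zmod_morphismD (A B : zmodType) (f : A -> B) :
  {morph f : x y / x + y} -> zmod_morphism f.
Proof.
by move=> fD x y; apply: (addIr (f y)); rewrite -fD subrK addrNK.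
Qed.

Section Action.
Variables (F F' : fp_functors R) (G G' : afunctor (Mod R) Ab).
Variables (eta : nattrans (sval F') (sval F)) (b : nattrans G G').

Definition smallnat_map (y : smallnat F G) : smallnat F' G' :=
  natsmall (comp_nat b (comp_nat (smallnat_nat y) eta)).

Lemma smallnat_map_subproof : zmod_morphism smallnat_map.
Proof.
apply: zmod_morphismD => y z.
rewrite /smallnat_map smallnat_natD -natsmallD; congr natsmall.
by rewrite comp_natDl comp_natDr.
Qed.

HB.instance Definition _ := GRing.isZmodMorphism.Build
  (smallnat F G) (smallnat F' G') smallnat_map smallnat_map_subproof.
End Action.

Lemma smallnat_map1 (F : fp_functors R) G (y : smallnat F G) :
  smallnat_map (id_nat (sval F)) (id_nat G) y = y.
Proof.
rewrite /smallnat_map -[RHS]smallnatK; congr natsmall.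
by rewrite comp_natm1 comp_nat1m.
Qed.

Lemma smallnat_mapM (F F' F'' : fp_functors R) G G' G''
    (e : nattrans (sval F') (sval F)) (e' : nattrans (sval F'') (sval F'))
    (b : nattrans G G') (b' : nattrans G' G'') (y : smallnat F G) :
  smallnat_map (comp_nat e e') (comp_nat b' b) y =
  smallnat_map e' b' (smallnat_map e b y).
Proof.
rewrite /smallnat_map natsmallK; congr natsmall.
by rewrite !comp_natA.
Qed.

Lemma smallnat_mapDr (F F' : fp_functors R) G G'
    (e : nattrans (sval F') (sval F)) (b b' : nattrans G G')
    (y : smallnat F G) :
  smallnat_map e (add_nat b b') y = smallnat_map e b y + smallnat_map e b' y.
Proof.
rewrite /smallnat_map -natsmallD; congr natsmall.
by rewrite comp_natDl.
Qed.

Lemma smallnat_mapDl (F F' : fp_functors R) G G'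
    (e e' : nattrans (sval F') (sval F)) (b : nattrans G G')
    (y : smallnat F G) :
  smallnat_map (add_nat e e') b y = smallnat_map e b y + smallnat_map e' b y.
Proof.
rewrite /smallnat_map -natsmallD; congr natsmall.
by rewrite !comp_natDr.
Qed.

Section DA.
Variable F : fp_functors R.

Definition DA_val (M : fp_right_mod R) : zmodType :=
  smallnat F (tensor_functor (sval M)).

Definition DA_map (M M' : fp_right_mod R) (f : hom M M') :
  {additive DA_val M -> DA_val M'} :=
  smallnat_map (id_nat (sval F)) (tensor_nat f).

Lemma DA_map1 (M : fp_right_mod R) : DA_map (idm M) = @idm Ab (DA_val M).
Proof.
apply: additive_ext => y; rewrite /DA_map /= tensor_nat1.
exact: smallnat_map1.
Qed.

Lemma DA_mapM (M M' M'' : fp_right_mod R) (g : hom M' M'') (f : hom M M') :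
  DA_map (comp g f) = @comp Ab _ _ _ (DA_map g) (DA_map f).
Proof.
apply: additive_ext => y; rewrite /DA_map /= tensor_natM.
rewrite -[X in smallnat_map X](comp_nat1m (id_nat (sval F))).
exact: smallnat_mapM.
Qed.

Lemma DA_mapD (M M' : fp_right_mod R) (f g : hom M M') :
  DA_map (addm f g) = @addm Ab _ _ (DA_map f) (DA_map g).
Proof.
apply: additive_ext => y; rewrite /DA_map /= tensor_natD.
exact: smallnat_mapDr.
Qed.

Definition DA_obj : afunctor (fp_right_mod R) Ab :=
  @AFunctor (fp_right_mod R) Ab
    (@Functor (fp_right_mod R) Ab DA_val DA_map DA_map1 DA_mapM) DA_mapD.

End DA.

Definition DA_eta (F F' : fp_functors R) (e : nattrans (sval F') (sval F)) :
  nattrans (DA_obj F) (DA_obj F').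
Proof.
refine (@NatTrans (fp_right_mod R) Ab (DA_obj F) (DA_obj F')
  (fun M => smallnat_map e (id_nat (tensor_functor (sval M))) :
     {additive DA_val F M -> DA_val F' M}) _).
move=> M M' f; apply: additive_ext => y.
transitivity (smallnat_map e (tensor_nat f) y).
  rewrite -[e in RHS]comp_natm1 -[tensor_nat f]comp_natm1.
  exact/esym/smallnat_mapM.
rewrite -[e in LHS]comp_nat1m -[tensor_nat f]comp_nat1m.
exact: smallnat_mapM.
Defined.

Definition DA : afunctor (fp_functors R) (op (functors (fp_right_mod R) Ab)).
Proof.
unshelve refine (@AFunctor (fp_functors R) (op (functors (fp_right_mod R) Ab))
  (@Functor (fp_functors R) (op (functors (fp_right_mod R) Ab))
     DA_obj (fun (F' F : fp_functors R) e => DA_eta e) _ _) _).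
- move=> F; apply: nattrans_ext => M; apply: additive_ext => y.
  exact: smallnat_map1.
- move=> F'' F' F e e'; apply: nattrans_ext => M; apply: additive_ext => y.
  transitivity (smallnat_map (comp_nat e e')
    (comp_nat (id_nat (tensor_functor (sval M))) (id_nat _)) y).
    by rewrite comp_nat1m.
  exact: smallnat_mapM.
- move=> F' F e e'; apply: nattrans_ext => M; apply: additive_ext => y.
  exact: smallnat_mapDl.
Defined.

End SmallNat.

(* Main.v *)
From HB Require Import structures.
From mathcomp Require Import all_boot all_algebra.
From mathcomp Require Import generic_quotient ring_quotient.
From mathcomp Require Import boolp classical_sets.
Require Import Defs.

Set Implicit Arguments.
Unset Strict Implicit.
Unset Printing Implicit Defensive.

Import GRing.Theory Num.Theory.
Local Open Scope ring_scope.

(** Write [- (x) X] for the functor [N |-> N (x) X] on finitely presented right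
    modules.  A finitely presented functor [F] with presentation
    [(B,-) -> (A,-) -> F -> 0] has [D_A F = ker (- (x) A -> - (x) B)], because a
    transformation [F -> N (x) -] is an element of [N (x) A] that dies in
    [N (x) B].  The theorem says that every functor [G] on finitely presented
    right modules is such a kernel, and that [G] determines [F] up to maps
    whose kernel and cokernel are killed by [D_A].

    The proof exhibits, for each [G], a universal arrow from [G] to [D_A] whose
    structure map is invertible, in other words a fully faithful left adjoint
    of [D_A] as a functor to the opposite category.  A functor with such an
    adjoint is the localization of its source at the maps it inverts
    ([localization_equivalent]), so it remains to see that the maps inverted by
    [D_A] are those whose kernel and cokernel are killed by [D_A].

    That last point ([serre_iso_DA_iso], [DA_iso_serre_iso]) is the exactness
    of [D_A]. Kernels and cokernels of maps of finitely presented functors are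
    finitely presented, since modules have cokernels and pushouts
    ([fp_kernel], [fp_cokernel]), and each [N (x) -] is injective relative to
    them ([nat_tensor_extend]): lifting a map to presentations turns the
    extension problem into a linear system over [N], which the right exactness
    of [N (x) -] solves.

    For the universal arrow, call [X] injective when [- (x) X] is an injective
    functor.  If [X] is a product of character modules [Hom (M_i, Q/Z)] with
    each [M_i] finitely presented, then [N (x) X] is the product of the groups
    [Hom (Hom (N, M_i), Q/Z)], by comparing both sides along a presentation of
    [N] ([char_ev_inj], [char_ev_surj]).  Hence maps [E -> - (x) X] are families
    of characters of the groups [E M_i], so that [X] is injective since [Q/Z]
    is, and every subfunctor of [E] is the kernel of such a map
    ([subfunctor_is_kernel]) since [Q/Z] cogenerates: take all characters that
    kill the subfunctor.  Doing this twice gives an exact sequence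
    [0 -> G -> - (x) X -> - (x) Y] with [X] and [Y] injective, and
    [- (x) X -> - (x) Y] comes from a map [phi : X -> Y]
    ([injective_copresentation]).  Let [S] be the cokernel of
    [(Y,-) -> (X,-)].  Then [D_A S = G].  Moreover maps [D_A F -> - (x) X] are
    elements of [F X] when [X] is injective ([DA_ev_represents],
    [DA_ev_separates]), so maps [D_A F -> G] are elements of [F X] killed by
    [F phi], and those are the maps [S -> F] ([DA_universal_arrow]). *)

(** * Abelian groups and modules: quotients, subgroups, factorizations *)

Lemma make_additive (A B : zmodType) (f : A -> B) :
  {morph f : x y / x + y} -> exists g : {additive A -> B}, g =1 f.
Proof.
move=> fD; pose H := GRing.isZmodMorphism.Build A B f (zmod_morphismD fD).
by exists (HB.pack_for {additive A -> B} f H).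
Qed.

Lemma make_linear (R : pzRingType) (A B : lmodType R) (f : A -> B) :
  {morph f : x y / x + y} -> (forall r, {morph f : x / r *: x}) ->
  exists g : {linear A -> B}, g =1 f.
Proof.
move=> fD fZ; pose H := GRing.isZmodMorphism.Build A B f (zmod_morphismD fD).
pose H' := GRing.isScalable.Build R A B *:%R f fZ.
by exists (HB.pack_for {linear A -> B} f H H').
Qed.

Section MakeModule.
Variables (R : pzRingType) (Q : zmodType) (s : R -> Q -> Q).
Hypotheses (sA : forall a b v, s a (s b v) = s (a * b) v) (s1 : left_id 1 s).
Hypotheses (sDr : right_distributive s +%R).
Hypotheses (sDl : forall v, {morph s^~ v : a b / a + b}).

(** The alias keeps the new scaling off [Q] itself. *)
Definition rescaled : Type := Q.
HB.instance Definition _ := GRing.Zmodule.on rescaled.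
HB.instance Definition _ :=
  GRing.Zmodule_isLmodule.Build R rescaled sA s1 sDr sDl.

Definition make_module : lmodType R := rescaled.
End MakeModule.

Lemma zmod_quotient (V : zmodType) (P : V -> Prop) :
  P 0 -> (forall x y, P x -> P y -> P (x - y)) ->
  exists (Q : zmodType) (p : {additive V -> Q}),
    (forall y, exists x, p x = y) /\ (forall x, p x = 0 <-> P x).
Proof.
move=> P0 PB; pose S : {pred V} := fun x => `[< P x >].
have SP : zmod_closed S.
  split; first exact/asboolP.
  by move=> x y /asboolP Px /asboolP Py; apply/asboolP/PB.
pose H := GRing.isZmodClosed.Build V S SP.
pose I : zmodClosed V := HB.pack_for (zmodClosed V) S H.
exists (Quotient.quot I), (\pi_(Quotient.quot I)%qT); split=> [y|x].
  by exists (repr y); apply: reprK.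
have -> : (0 : Quotient.quot I) = \pi_(Quotient.quot I)%qT 0.
  by rewrite pi_zeror.
have E : (\pi_(Quotient.quot I) x == \pi_(Quotient.quot I) 0)%qT =
    (x - 0 \in S).
  by rewrite eqmodE.
rewrite subr0 in E; split=> [/eqP|Px]; first by rewrite E => /asboolP.
by apply/eqP; rewrite E; apply/asboolP.
Qed.

Lemma additive_eq (A B : zmodType) (f g : {additive A -> B}) x :
  f = g -> f x = g x.
Proof. by move->. Qed.

Lemma additive_factor (A B C : zmodType) (p : {additive A -> B})
    (g : {additive A -> C}) :
  (forall y, exists x, p x = y) -> (forall x, p x = 0 -> g x = 0) ->
  exists h : {additive B -> C}, forall x, h (p x) = g x.
Proof.
move=> p_surj kerp; have [s sK] := choice p_surj.
have E x x' : p x = p x' -> g x = g x'.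
  move=> xx'; apply/eqP; rewrite -subr_eq0 -raddfB; apply/eqP/kerp.
  by rewrite raddfB xx' subrr.
have [|h hE] := @make_additive B C (g \o s).
  by move=> x y; rewrite /= -raddfD; apply: E; rewrite raddfD !sK.
by exists h => x; rewrite hE /=; apply: E; rewrite sK.
Qed.

Lemma linear_factor (R : pzRingType) (A B C : lmodType R) (p : {linear A -> B})
    (g : {linear A -> C}) :
  (forall y, exists x, p x = y) -> (forall x, p x = 0 -> g x = 0) ->
  exists h : {linear B -> C}, forall x, h (p x) = g x.
Proof.
move=> p_surj kerp; have [h0 h0E] := additive_factor p_surj kerp.
have [|r y|h hE] := @make_linear R B C h0; first exact: raddfD.
  by have [x <-] := p_surj y; rewrite -[r *: p x]linearZ_LR !h0E /= linearZ_LR.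
by exists h => x; rewrite hE h0E.
Qed.

Lemma additive_lift (A B C : zmodType) (i : {additive B -> C})
    (g : {additive A -> C}) :
  injective i -> (forall x, exists y, i y = g x) ->
  exists h : {additive A -> B}, forall x, i (h x) = g x.
Proof.
move=> i_inj im; have [s sK] := choice im.
have [|h hE] := @make_additive A B s.
  by move=> x y; apply: i_inj; rewrite raddfD !sK raddfD.
by exists h => x; rewrite hE sK.
Qed.

Lemma zmod_subgroup (V : zmodType) (P : V -> Prop) :
  P 0 -> (forall x y, P x -> P y -> P (x - y)) ->
  exists (K : zmodType) (i : {additive K -> V}),
    injective i /\ (forall x, (exists y, i y = x) <-> P x).
Proof.
move=> P0 PB; pose S : {pred V} := fun x => `[< P x >].
have SP : zmod_closed S.
  split; first exact/asboolP.
  by move=> x y /asboolP Px /asboolP Py; apply/asboolP/PB.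
pose T := {x : V | S x}.
pose TZ := GRing.SubChoice_isSubZmodule.Build V S T SP.
pose K : zmodType := HB.pack_for zmodType T TZ.
have [|i iE] := @make_additive K V val; first by [].
exists K, i; split=> [x y|x]; first by rewrite !iE; apply: val_inj.
split=> [[y <-]|Px].
  by rewrite iE; apply/asboolP; apply: (valP y).
by exists (Sub x (asboolT Px)); rewrite iE.
Qed.

Lemma mod_quotient (R : pzRingType) (V : lmodType R) (P : V -> Prop) :
  P 0 -> (forall x y, P x -> P y -> P (x - y)) ->
  (forall r x, P x -> P (r *: x)) ->
  exists (Q : lmodType R) (p : {linear V -> Q}),
    (forall y, exists x, p x = y) /\ (forall x, p x = 0 <-> P x).
Proof.
move=> P0 PB PZ; have [Q [p [p_surj kerp]]] := zmod_quotient P0 PB.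
have scalex r : exists h : {additive Q -> Q}, forall x, h (p x) = p (r *: x).
  have [g gE] := @make_additive V Q (fun x => p (r *: x))
    (fun x y => etrans (congr1 p (scalerDr r x y)) (raddfD p _ _)).
  have [x /(proj1 (kerp x)) Px|h hE] := additive_factor p_surj (g := g).
    by rewrite gE; apply/(proj2 (kerp _)); apply: PZ.
  by exists h => x; rewrite hE gE.
have [s sE] := choice scalex.
have sA a b v : s a (s b v) = s (a * b) v.
  by have [x <-] := p_surj v; rewrite !sE scalerA.
have s1 : left_id 1 (fun r v => s r v).
  by move=> v; have [x <-] := p_surj v; rewrite sE scale1r.
have sDr : right_distributive (fun r v => s r v) +%R.
  by move=> r v w; apply: raddfD.
have sDl v : {morph (fun r => s r v) : a b / a + b}.
  by move=> a b; have [x <-] := p_surj v; rewrite !sE scalerDl raddfD.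
pose Q' := make_module sA s1 sDr sDl.
have [||p' p'E] := @make_linear R V Q' p; first exact: raddfD.
  by move=> r x; rewrite -sE.
by exists Q', p'; split=> [y|x]; [have [x xy] := p_surj y; exists x|];
  rewrite p'E.
Qed.


(** * Extending homomorphisms into a divisible group *)

Lemma subgroup_scale (V : zmodType) (P : V -> Prop) x (k : int) :
  P 0 -> (forall x y, P x -> P y -> P (x - y)) -> P x -> P (x *~ k).
Proof.
move=> P0 PB Px; have PN y : P y -> P (- y) by rewrite -sub0r; apply: PB.
have PM (m : nat) : P (x *+ m).
  elim: m => [|m IH] //; rewrite mulrS -[x *+ m]opprK.
  by apply: PB => //; apply: PN.
by case: k => m; [exact: PM|rewrite NegzE mulrNz; apply: PN; exact: PM].
Qed.

(** Euclidean division by the least positive element; [n = 0] covers the zero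
    subgroup. *)
Lemma int_subgroup_cyclic (P : int -> Prop) :
  P 0 -> (forall k l, P k -> P l -> P (k - l)) ->
  exists n : nat, P n%:Z /\ forall k, P k -> exists j, k = n%:Z *~ j.
Proof.
move=> P0 PB.
have [[n0 n0P]|none] := pselect (exists n : nat, (0 < n)%N && `[< P n%:Z >]).
  have ex : exists n : nat, (0 < n)%N && `[< P n%:Z >] by exists n0.
  case: (ex_minnP ex) => n /andP[n_gt0 /asboolP Pn] nmin.
  exists n; split=> // k Pk; exists (k %/ n)%Z.
  rewrite {1}(divz_eq k n) mulrzz [RHS]mulrC.
  have n_neq0 : n%:Z != 0 by rewrite eqz_nat -lt0n.
  have : P (k %% n)%Z.
    rewrite /modz; apply: (PB) => //.
    by rewrite mulrC -mulrzz; apply: (subgroup_scale _ P0 PB).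
  have : (k %% n)%Z < n%:Z by rewrite ltz_pmod.
  case: (k %% n)%Z (modz_ge0 k n_neq0) => // -[|r] _; first by rewrite addr0.
  by rewrite ltz_nat => ltrn Pr; have := nmin r.+1 (asboolT Pr);
    rewrite leqNgt ltrn.
exists 0%N; split=> // k Pk; exists 0; rewrite mulr0z.
case: (intP k) Pk => // n Pn; case: none; exists n.+1; apply/asboolP => //.
by rewrite -[n.+1%:Z]opprK -sub0r; apply: PB.
Qed.

Section Extension.
Variables (A B D : zmodType) (f : {additive A -> B}) (chi : {additive A -> D}).
Hypothesis divD : forall n (d : D), (0 < n)%N -> exists e, e *+ n = d.
Hypothesis kerf : forall a, f a = 0 -> chi a = 0.

Local Open Scope classical_set_scope.

(** Graphs of partial extensions of [chi] along [f].  The last clause is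
    vacuous for the empty graph, so that the union of the empty chain is
    allowed in the application of Zorn's lemma. *)
Definition partial_ext (G : set (B * D)) : Prop :=
  [/\ forall b d b' d', G (b, d) -> G (b', d') -> G (b - b', d - d'),
      forall d, G (0, d) -> d = 0 &
      forall x, G x -> forall a, G (f a, chi a)].

Lemma partial_ext_max :
  exists G, partial_ext G /\ forall H, G `<` H -> ~ partial_ext H.
Proof.
apply: Zorn_bigcup => F FP tF.
split=> [b d b' d' [X FX Xx] [Y FY Yy]|d [X FX]|x].
- have [XY|YX] := tF _ _ FX FY.
    by exists Y => //; have [+ _ _] := FP _ FY; apply=> //; apply: XY.
  by exists X => //; have [+ _ _] := FP _ FX; apply=> //; apply: YX.
- by have [_ + _] := FP _ FX; apply.
by move=> [X FX Xx] a; exists X => //; have [_ _ /(_ x Xx)] := FP _ FX.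
Qed.

(** The graph of a maximal partial extension is total: a missing [b] would
    have its multiples in the domain generated by one [n b], and divisibility
    provides a value [d] for [b] with [n d] the value at [n b]. *)
Lemma additive_extension :
  exists g : {additive B -> D}, forall a, g (f a) = chi a.
Proof.
have [G [[GB G0 Gf] Gmax]] := partial_ext_max.
have Gfa a : G (f a, chi a).
  have [[x Gx]|G_empty] := pselect (exists x, G x); first exact: Gf Gx a.
  exfalso; apply: (Gmax [set x | exists a, x = (f a, chi a)]).
    split; first by move=> x Gx; case: G_empty; exists x.
    move=> /(_ (f a, chi a)) Ga; apply: G_empty; exists (f a, chi a).
    by apply: Ga; exists a.
  split=> [b d b' d' [c [-> ->]] [c' [-> ->]]
          |d [b [/esym /kerf + ->]]|x _ b] //.
    by exists (c - c'); rewrite !raddfB.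
  by exists b.
have G00 : G (0, 0) by have := Gfa 0; rewrite !raddf0.
have GN b d : G (b, d) -> G (- b, - d).
  by move=> Gx; have := GB _ _ _ _ G00 Gx; rewrite !sub0r.
have GD b d b' d' : G (b, d) -> G (b', d') -> G (b + b', d + d').
  by move=> Gx /GN Gy; rewrite -[b']opprK -[d']opprK; apply: GB.
have GM b d k : G (b, d) -> G (b *~ k, d *~ k).
  have -> : (b *~ k, d *~ k) = (b, d) *~ k.
    rewrite [RHS]surjective_pairing; congr (_, _).
      exact: esym (raddfMz fst k (b, d)).
    exact: esym (raddfMz snd k (b, d)).
  by apply: subgroup_scale => // -[? ?] [? ?]; apply: GB.
have Gtot b : exists d, G (b, d).
  apply: contrapT => nb.
  have [||n [[dn Gn] nP]] :=
      @int_subgroup_cyclic (fun k => exists d, G (b *~ k, d)).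
  - by exists 0; rewrite mulr0z.
  - move=> k l [d Gk] [e Gl]; exists (d - e).
    by rewrite mulrzBr; apply: GB.
  have [d nd] : exists d, d *~ n%:Z = dn.
    case: (posnP n) Gn => [->|n_gt0 _]; last exact: divD.
    by rewrite mulr0z => /G0 ->; exists 0.
  rewrite -{dn}nd in Gn.
  apply: (Gmax [set y | exists x e k,
    G (x, e) /\ y = (x + b *~ k, e + d *~ k)]).
    split=> [[x e] Gx|sub]; first by exists x, e, 0; rewrite !mulr0z !addr0.
    apply: nb; exists d; apply: sub; exists 0, 0, 1.
    by rewrite !mulr1z !add0r.
  split=> [_ _ _ _ [x [e [k [Gx [-> ->]]]]] [y [e' [l [Gy [-> ->]]]]]
          |_ [x [e [k [Gx [xk ->]]]]]|_ _ a].
  - exists (x - y), (e - e'), (k - l); split; first exact: GB.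
    by congr (_, _); rewrite mulrzBr opprD addrACA.
  - have bk : b *~ k = - x by apply/eqP; rewrite -addr_eq0 addrC -xk.
    have [|j kj] := nP k; first by exists (- e); rewrite bk; apply: GN.
    rewrite kj [n%:Z *~ j]mulrzz !mulrzA in bk *.
    apply: G0; rewrite xk kj [n%:Z *~ j]mulrzz !mulrzA.
    by apply: GD => //; apply: GM.
  by exists (f a), (chi a), 0; rewrite !mulr0z !addr0; split.
have [g gG] := choice Gtot.
have Gfun b d : G (b, d) -> g b = d.
  move=> Gb; apply/eqP; rewrite -subr_eq0; apply/eqP/G0.
  by have := GB _ _ _ _ (gG b) Gb; rewrite subrr.
have [|h hE] := @make_additive B D g.
  by move=> x y; apply: Gfun; apply: GD.
by exists h => a; rewrite hE; apply: Gfun.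
Qed.

End Extension.

(** * Characters with values in Q/Z *)

Lemma QZ_exists : exists (Q : zmodType) (p : {additive rat -> Q}),
  (forall y, exists x, p x = y) /\ (forall x, p x = 0 <-> x \is a Num.int).
Proof.
apply: (zmod_quotient (P := fun x => x \is a Num.int)) => [|x y xZ yZ].
  exact: rpred0.
exact: rpredB.
Qed.

Definition QZ : zmodType := projT1 (cid QZ_exists).

Lemma QZ_divisible n (d : QZ) : (0 < n)%N -> exists e, e *+ n = d.
Proof.
rewrite /QZ in d *; case: cid d => Q [p [p_surj _]] /= d n_gt0.
have [x <-] := p_surj d; exists (p (x / n%:R)).
by rewrite -raddfMn -[_ *+ n]mulr_natr divfK // pnatr_eq0 -lt0n.
Qed.

Lemma QZ_torsion n : (1 < n)%N -> exists2 d : QZ, d *+ n = 0 & d <> 0.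
Proof.
rewrite /QZ; case: cid => Q [p [_ kerp]] /= n_gt1.
have n_neq0 : n%:R != 0 :> rat by rewrite pnatr_eq0 -lt0n ltnW.
exists (p (n%:R^-1)).
  by rewrite -raddfMn -[_ *+ n]mulr_natr mulVf //; apply/kerp/rpred1.
move=> /kerp /intrP[k kE].
have : (n%:Z * k)%:~R = 1 :> rat by rewrite intrM -kE divff.
move/eqP; rewrite (eqr_int _ _ 1) => /eqP nk.
have /eqP := congr1 absz nk; rewrite abszM muln_eq1 => /andP[/eqP n1 _].
by rewrite -[n]/(`|n%:Z|%N) n1 in n_gt1.
Qed.

Lemma character_extension (A B : zmodType) (f : {additive A -> B})
    (chi : {additive A -> QZ}) : (forall a, f a = 0 -> chi a = 0) ->
  exists g : {additive B -> QZ}, forall a, g (f a) = chi a.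
Proof. by apply: additive_extension; apply: QZ_divisible. Qed.

Lemma cyclic_additive (A : zmodType) (a : A) :
  exists f : {additive int -> A}, forall k, f k = a *~ k.
Proof. by apply: make_additive => k l; rewrite mulrzDr. Qed.

(** The order [n] of [a] (zero when infinite) is never [1], so [Q/Z] contains a
    nonzero [d] with [n d = 0]; the map [k a |-> k d] then extends to [A]. *)
Lemma character_separation (A : zmodType) (a : A) :
  a <> 0 -> exists chi : {additive A -> QZ}, chi a <> 0.
Proof.
move=> a_neq0; have [f fE] := cyclic_additive a.
have [||n [an nP]] := @int_subgroup_cyclic (fun k => a *~ k = 0).
- exact: mulr0z.
- by move=> k l ak al; rewrite mulrzBr ak al subrr.
have [d dn d_neq0] : exists2 d : QZ, d *+ n = 0 & d <> 0.
  case: n an {nP} => [|[|n]] an; last exact: QZ_torsion.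
    (* For [a] of infinite order any nonzero [d] will do. *)
    by have [d _ d_neq0] := QZ_torsion (leqnn 2); exists d.
  by case: a_neq0; rewrite -[a]mulr1z.
have [g gE] := cyclic_additive d.
have [k|chi chiE] := character_extension (f := f) (chi := g).
  rewrite fE gE => /nP[j ->].
  by rewrite mulrzz mulrzA -pmulrn dn mul0rz.
exists chi; have := chiE 1; rewrite fE gE !mulr1z => ->; exact: d_neq0.
Qed.

Lemma character_separation_subgroup (A : zmodType) (P : A -> Prop) (a : A) :
  P 0 -> (forall x y, P x -> P y -> P (x - y)) -> ~ P a ->
  exists chi : {additive A -> QZ}, (forall x, P x -> chi x = 0) /\ chi a <> 0.
Proof.
move=> P0 PB Pa; have [Q [p [_ kerp]]] := zmod_quotient P0 PB.
have [|chi chi_a] := @character_separation Q (p a); first by move/kerp.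
by exists (chi \o p); split=> // x /kerp /= ->; rewrite raddf0.
Qed.

(** * Functors to abelian groups *)

Lemma dep_choice (I : Type) (T : I -> Type) (P : forall i, T i -> Prop) :
  (forall i, exists t, P i t) -> exists f : forall i, T i, forall i, P i (f i).
Proof. by move=> ex; exists (fun i => projT1 (cid (ex i))) => i; case: cid. Qed.

Section FunctorsToAb.
Variable C : preadditive.
Implicit Types F G H : afunctor C Ab.

(** Objects and maps of [Ab] are groups and homomorphisms only up to
    conversion; [grp], [act] and [app] give the values of functors and
    transformations the types on which the algebraic notation works. *)
Definition grp F (x : C) : zmodType := F x.
Definition act F (x y : C) (f : hom x y) : {additive grp F x -> grp F y} :=
  fmap F f.
Definition app F G (a : nattrans F G) (x : C) : {additive grp F x -> grp G x} :=
  a x.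

Lemma act1 F x v : act F (idm x) v = v.
Proof. by rewrite /act fmap1. Qed.

Lemma actM F x y z (g : hom y z) (f : hom x y) v :
  act F (comp g f) v = act F g (act F f v).
Proof. by rewrite /act fmapM. Qed.

Lemma actD F x y (f g : hom x y) v :
  act F (addm f g) v = act F f v + act F g v.
Proof. by rewrite /act fmapD. Qed.

Lemma act0 F x y v : act F (zerom x y) v = 0.
Proof. by apply: (addIr (act F (zerom x y) v)); rewrite -actD add0m add0r. Qed.

Lemma actN F x y (f : hom x y) v : act F (oppm f) v = - act F f v.
Proof. by apply/eqP; rewrite -addr_eq0 -actD addNm act0. Qed.

Lemma act_app F G (a : nattrans F G) x y (f : hom x y) v :
  act G f (app a x v) = app a y (act F f v).
Proof.
exact: (congr1 (fun h : {additive grp F x -> grp G y} => h v) (ntcP a f)).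
Qed.

Lemma app_ext F G (a b : nattrans F G) :
  (forall x v, app a x v = app b x v) -> a = b.
Proof.
by move=> ab; apply: nattrans_ext => x; apply: additive_ext => v; apply: ab.
Qed.

Lemma app_comp F G H (b : nattrans G H) (a : nattrans F G) x v :
  app (comp_nat b a) x v = app b x (app a x v).
Proof. by []. Qed.

Lemma make_nat F G (a : forall x, {additive grp F x -> grp G x}) :
  (forall x y (f : hom x y) v, act G f (a x v) = a y (act F f v)) ->
  exists t : nattrans F G, forall x v, app t x v = a x v.
Proof.
move=> aP; have aP' x y (f : hom x y) :
    comp (fmap G f) (a x : @hom Ab (F x) (G x)) =
    comp (a y : @hom Ab (F y) (G y)) (fmap F f).
  by apply: additive_ext => v; apply: aP.
by exists (NatTrans aP').
Qed.

Section MakeFunctor.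
Variable T : C -> zmodType.
Variable m : forall x y, hom x y -> {additive T x -> T y}.
Hypothesis m1 : forall x v, m (idm x) v = v.
Hypothesis mM : forall x y z (g : hom y z) (f : hom x y) v,
  m (comp g f) v = m g (m f v).
Hypothesis mD : forall x y (f g : hom x y) v, m (addm f g) v = m f v + m g v.

Definition make_functor : afunctor C Ab :=
  @AFunctor C Ab (@Functor C Ab T m
    (fun x => additive_ext (f := m (idm x)) (g := idfun) (m1 (x := x)))
    (fun x y z g f =>
       additive_ext (f := m (comp g f)) (g := m g \o m f) (mM g f)))
    (fun x y f g =>
       additive_ext (f := m (addm f g)) (g := m f \+ m g) (mD f g)).
End MakeFunctor.

Definition is_subfunctor F (P : forall x, grp F x -> Prop) : Prop :=
  [/\ forall x, P x 0, forall x v w, P x v -> P x w -> P x (v - w) &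
      forall x y (f : hom x y) v, P x v -> P y (act F f v)].

Lemma nat_factor F G H (p : nattrans F G) (g : nattrans F H) :
  (forall x v, exists w, app p x w = v) ->
  (forall x v, app p x v = 0 -> app g x v = 0) ->
  exists h : nattrans G H, comp_nat h p = g.
Proof.
move=> p_surj kerp.
have [h hE] := dep_choice (fun x => additive_factor (p_surj x) (kerp x)).
have [x y f v|t tE] := @make_nat G H h.
  by have [w <-] := p_surj x v; rewrite hE act_app act_app hE.
by exists t; apply: app_ext => x v; rewrite app_comp tE hE.
Qed.

Lemma nat_lift F G H (i : nattrans G H) (g : nattrans F H) :
  (forall x, injective (app i x)) ->
  (forall x v, exists w, app i x w = app g x v) ->
  exists h : nattrans F G, comp_nat i h = g.
Proof.
move=> i_inj im.
have [h hE] := dep_choice (fun x => additive_lift (i_inj x) (im x)).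
have [x y f v|t tE] := @make_nat F G h.
  by apply: i_inj; rewrite -act_app !hE act_app.
by exists t; apply: app_ext => x v; rewrite app_comp tE hE.
Qed.

Lemma quotient_functor_exists F (P : forall x, grp F x -> Prop) :
  is_subfunctor P ->
  exists (Q : afunctor C Ab) (p : nattrans F Q),
    forall x, (forall v, exists w, app p x w = v) /\
      (forall v, app p x v = 0 <-> P x v).
Proof.
move=> [P0 PB Pf].
have [T TP] := dep_choice (fun x => zmod_quotient (P0 x) (PB x)).
have [p /all_and2[p_surj kerp]] := dep_choice TP.
have mP x y (f : hom x y) : exists h : {additive T x -> T y},
    forall v, h (p x v) = p y (act F f v).
  have [v /kerp Pv|h hE] := additive_factor (g := p y \o act F f) (p_surj x).
    exact/kerp/Pf.
  by exists h.
pose m x y (f : hom x y) := projT1 (cid (mP x y f)).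
have mE x y (f : hom x y) v : m x y f (p x v) = p y (act F f v).
  by rewrite /m; case: cid.
have m1 x v : m x x (idm x) v = v.
  by have [w <-] := p_surj x v; rewrite mE act1.
have mM x y z (g : hom y z) (f : hom x y) v :
    m x z (comp g f) v = m y z g (m x y f v).
  by have [w <-] := p_surj x v; rewrite !mE actM.
have mD x y (f g : hom x y) v : m x y (addm f g) v = m x y f v + m x y g v.
  by have [w <-] := p_surj x v; rewrite !mE actD raddfD.
have [x y f v|t tE] := @make_nat F (make_functor m1 mM mD) p.
  exact: mE.
exists (make_functor m1 mM mD), t => x; split=> [v|v]; last by rewrite tE.
by have [w wE] := p_surj x v; exists w; rewrite tE.
Qed.

Lemma subfunctor_exists F (P : forall x, grp F x -> Prop) :
  is_subfunctor P ->
  exists (K : afunctor C Ab) (i : nattrans K F),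
    forall x, injective (app i x) /\
      (forall v, (exists w, app i x w = v) <-> P x v).
Proof.
move=> [P0 PB Pf].
have [T TP] := dep_choice (fun x => zmod_subgroup (P0 x) (PB x)).
have [i /all_and2[i_inj im]] := dep_choice TP.
have mP x y (f : hom x y) : exists h : {additive T x -> T y},
    forall v, i y (h v) = act F f (i x v).
  have [v|h hE] := additive_lift (g := act F f \o i x) (i_inj y).
    by apply/im/Pf/im; exists v.
  by exists h.
pose m x y (f : hom x y) := projT1 (cid (mP x y f)).
have mE x y (f : hom x y) v : i y (m x y f v) = act F f (i x v).
  by rewrite /m; case: cid.
have m1 x v : m x x (idm x) v = v by apply: i_inj; rewrite mE act1.
have mM x y z (g : hom y z) (f : hom x y) v :
    m x z (comp g f) v = m y z g (m x y f v).
  by apply: i_inj; rewrite !mE actM.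
have mD x y (f g : hom x y) v : m x y (addm f g) v = m x y f v + m x y g v.
  by apply: i_inj; rewrite raddfD !mE actD.
have [x y f v|t tE] := @make_nat (make_functor m1 mM mD) F i.
  by rewrite -mE.
exists (make_functor m1 mM mD), t => x; split=> [v w|v].
  by rewrite !tE => /i_inj.
by rewrite -im; split=> -[w <-]; exists w; rewrite tE.
Qed.

Lemma nat_iso F G (a : nattrans F G) :
  @is_iso (functors C Ab) F G a <->
  (forall x, injective (app a x)) /\ (forall x v, exists w, app a x w = v).
Proof.
split=> [[b [ba ab]]|[a_inj a_surj]].
  have baE x v : app b x (app a x v) = v.
    exact: (congr1 (fun c : nattrans F F => app c x v) ba).
  have abE x v : app a x (app b x v) = v.
    exact: (congr1 (fun c : nattrans G G => app c x v) ab).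
  split=> x; first exact: can_inj (baE x).
  by move=> v; exists (app b x v).
have [b ab] := nat_lift (g := id_nat G) a_inj a_surj.
exists b; split; last exact: ab.
apply: app_ext => x v; apply: a_inj.
exact: (congr1 (fun c : nattrans G G => app c x (app a x v)) ab).
Qed.

End FunctorsToAb.

(** * Finitely presented functors on left modules *)

Section Presentations.
Variable R : pzRingType.
Implicit Types (F G : afunctor (Mod R) Ab) (X Y Z M N L : lmodType R).

(** [act] with the maps of [Mod R] typed as linear functions.  The lemmas on
    composites and differences ask for pointwise equations, since the maps to
    which they apply come from universal properties that give values only. *)
Definition lact F M N (f : {linear M -> N}) : {additive grp F M -> grp F N} :=
  @act (Mod R) F M N f.

Lemma lact1 F M v : lact F (idfun : {linear M -> M}) v = v.
Proof. exact: act1. Qed.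

Lemma lactM F M N L (g : {linear N -> L}) (f : {linear M -> N})
    (h : {linear M -> L}) v :
  (forall x, h x = g (f x)) -> lact F h v = lact F g (lact F f v).
Proof.
move=> hE; rewrite -[RHS]actM; congr (lact F _ v).
by apply: linear_ext => x; apply: hE.
Qed.

Lemma lactB F M N (f g h : {linear M -> N}) v :
  (forall x, h x = f x - g x) -> lact F h v = lact F f v - lact F g v.
Proof.
move=> hE; rewrite -[X in _ - X]/(act F _ v) -actN -[RHS]actD.
by congr (lact F _ v); apply: linear_ext => x; apply: hE.
Qed.

Lemma lact_app F G (a : nattrans F G) M N (f : {linear M -> N}) v :
  lact G f (app a M v) = app a N (lact F f v).
Proof. exact: act_app. Qed.

Definition spans F X (a : grp F X) : Prop :=
  forall M (v : grp F M), exists h : {linear X -> M}, lact F h a = v.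

(** By Yoneda, an exact sequence [(Y,-) -> (X,-) -> F -> 0] amounts to an
    element [a] of [F X], the image of the identity of [X], and a map
    [b : X -> Y]; this is exactness at [F] and at [(X,-)] in terms of [a]
    and [b]. *)
Definition presents F X Y (b : {linear X -> Y}) (a : grp F X) : Prop :=
  spans a /\ forall M (h : {linear X -> M}),
    lact F h a = 0 <-> exists k : {linear Y -> M}, forall x, h x = k (b x).

Lemma presents0 F X Y (b : {linear X -> Y}) (a : grp F X) :
  presents b a -> lact F b a = 0.
Proof. by move=> [_ /(_ _ b)[_]]; apply; exists idfun. Qed.

Lemma spans_nat_ext F G X (a : grp F X) (s t : nattrans F G) :
  spans a -> app s X a = app t X a -> s = t.
Proof.
move=> a_spans st; apply: app_ext => M v.
by have [h <-] := a_spans M v; rewrite -!lact_app st.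
Qed.

(** A transformation out of [F] is a value for the generator that satisfies the
    relation [b]. *)
Lemma presents_nat F G X Y (b : {linear X -> Y}) (a : grp F X) (z : grp G X) :
  presents b a -> lact G b z = 0 -> exists t : nattrans F G, app t X a = z.
Proof.
move=> [a_spans ker] bz.
have E M (h h' : {linear X -> M}) :
    lact F h a = lact F h' a -> lact G h z = lact G h' z.
  move=> hh'; apply/eqP; rewrite -subr_eq0 -(@lactB _ _ _ _ _ (h \- h')) //.
  apply/eqP; have [|k kE] := proj1 (ker M (h \- h')).
    by rewrite (@lactB _ _ _ h h') // hh' subrr.
  by rewrite (lactM _ kE) bz raddf0.
have tP M : exists t : {additive grp F M -> grp G M},
    forall h : {linear X -> M}, t (lact F h a) = lact G h z.
  have [s sK] := choice (a_spans M).
  have [|t tE] := @make_additive (grp F M) (grp G M) (fun v => lact G (s v) z).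
    move=> v w; rewrite -[RHS](@actD (Mod R)); apply: E.
    by rewrite sK [lact F _ _](@actD (Mod R)) !sK.
  by exists t => h; rewrite tE; apply: E; rewrite sK.
have [t tE] := dep_choice tP.
have [M N f v|u uE] := @make_nat (Mod R) F G t.
  have [h <-] := a_spans M v.
  rewrite tE -[act F f _](@lactM _ _ _ _ f h (f \o h)) // tE.
  exact/esym/lactM.
exists u; rewrite uE -[X in t _ X]lact1 tE; exact: lact1.
Qed.

Definition yoneda_elt X : grp (representable X) X := (idfun : {linear X -> X}).

Lemma lact_yoneda X M (h : {linear X -> M}) :
  lact (representable X) h (yoneda_elt X) = h.
Proof. exact: linear_ext. Qed.

Lemma spans_yoneda X : spans (yoneda_elt X).
Proof. by move=> M h; exists h; apply: lact_yoneda. Qed.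

Lemma presents_representable X :
  presents (\0 : {linear X -> X}) (yoneda_elt X).
Proof.
split=> [|M h]; first exact: spans_yoneda.
rewrite lact_yoneda; split=> [->|[k kE]]; first by exists \0.
by apply: linear_ext => x; rewrite kE raddf0.
Qed.

Lemma yoneda_map F X (z : grp F X) :
  exists t : nattrans (representable X) F,
    forall M (h : {linear X -> M}), app t M h = lact F h z.
Proof.
have [|t tE] := presents_nat (G := F) (z := z) (presents_representable X).
  exact: (@act0 (Mod R) F X X z).
exists t => M h; rewrite -tE lact_app; congr (app t M _).
by rewrite lact_yoneda.
Qed.

Lemma fp_functorP F :
  fp_functor F <-> exists X Y (b : {linear X -> Y}) (a : grp F X), presents b a.
Proof.
split=> [[X [Y [q [p pq]]]]|[X [Y [b [a [a_spans ker]]]]]].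
  have pE M (h : grp (representable X) M) :
      app p M h = lact F h (app p X (yoneda_elt X)).
    by rewrite lact_app lact_yoneda.
  have qE M (k : grp (representable Y) M) :
      evn q M k = lact _ k (app q Y (yoneda_elt Y)).
    by rewrite -[LHS]/(app q M k) lact_app lact_yoneda.
  exists X, Y, (app q Y (yoneda_elt Y)), (app p X (yoneda_elt X)).
  split=> [M v|M h].
    by have [/(_ v)[h <-] _] := pq M; exists h; rewrite -pE.
  have [_ /(_ h) kerp] := pq M; rewrite -pE kerp.
  split=> -[k kE]; exists k; first by move=> x; rewrite -kE qE.
  by rewrite qE; apply: linear_ext => x; rewrite kE.
have [p pE] := yoneda_map a; have [q qE'] := @yoneda_map (representable X) Y b.
have qE M k : evn q M k = lact (representable X) k b := qE' M k.
exists X, Y, q, p => M; split=> [v|h].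
  by have [h <-] := a_spans M v; exists h; apply: pE.
rewrite -[evn p M h]/(app p M h) pE ker.
split=> -[k kE]; exists k; last by move=> x; rewrite -kE qE.
by rewrite qE; apply: linear_ext => x; rewrite kE.
Qed.

Lemma representable_fp X : fp_functor (representable X).
Proof.
apply/fp_functorP; exists X, X, \0, (yoneda_elt X).
exact: presents_representable.
Qed.

Lemma presented_functor_exists X Y (b : {linear X -> Y}) :
  exists F (a : grp F X), presents b a.
Proof.
have [|Q [p pP]] := @quotient_functor_exists (Mod R) (representable X)
    (fun M (h : {linear X -> M}) =>
       exists k : {linear Y -> M}, forall x, h x = k (b x)).
  split=> [M|M h h' [k kE] [k' k'E]|M N f h [k kE]].
  - by exists \0.
  - by exists (k \- k') => x; rewrite /= -kE -k'E.
  - by exists (f \o k) => x; rewrite /= -kE.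
exists Q, (app p X (yoneda_elt X)); split=> [M v|M h].
  have [/(_ v)[h <-] _] := pP M.
  by exists h; rewrite lact_app lact_yoneda.
by have [_ kerp] := pP M; rewrite lact_app lact_yoneda kerp.
Qed.

Lemma pushout X Y Z (f : {linear X -> Y}) (g : {linear X -> Z}) :
  exists (P : lmodType R) (p : {linear (Y * Z)%type -> P}),
    (forall v, exists w, p w = v) /\
    (forall w, p w = 0 <-> exists x, w = (f x, - g x)).
Proof.
apply: mod_quotient => [|_ _ [x ->] [y ->]|r _ [x ->]].
- by exists 0; rewrite !raddf0.
- by exists (x - y); rewrite !raddfB.
- by exists (r *: x); rewrite !linearZ_LR.
Qed.

Lemma linear_pair X Y Z (f : {linear X -> Z}) (g : {linear Y -> Z}) :
  exists h : {linear (X * Y)%type -> Z}, forall x y, h (x, y) = f x + g y.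
Proof.
have [[x y] [x' y']|r [x y]|h hE] :=
    @make_linear R (X * Y)%type Z (fun w => f w.1 + g w.2).
- by rewrite /= !raddfD addrACA.
- by rewrite /= !linearZ scalerDr.
by exists h => x y; rewrite hE.
Qed.

Lemma linear_pairing X Y Z (f : {linear X -> Y}) (g : {linear X -> Z}) :
  exists h : {linear X -> (Y * Z)%type}, forall x, h x = (f x, g x).
Proof.
by apply: make_linear => [x y|r x]; congr (_, _); rewrite ?raddfD ?linearZ.
Qed.

Lemma linear_inl X Y :
  exists h : {linear X -> (X * Y)%type}, forall x, h x = (x, 0).
Proof.
apply: make_linear => [x y|r x]; congr (_, _); rewrite ?addr0 //.
by rewrite scaler0.
Qed.

Lemma linear_inr X Y :
  exists h : {linear Y -> (X * Y)%type}, forall y, h y = (0, y).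
Proof.
apply: make_linear => [x y|r x]; congr (_, _); rewrite ?addr0 //.
by rewrite scaler0.
Qed.

(** With [f] lifted to [phi : A' -> A], the cokernel is generated by the
    generator [a'] of [G], subject to the relations given by
    [(phi, b') : A' -> A * B']. *)
Lemma fp_cokernel F G (f : nattrans F G) : fp_functor F -> fp_functor G ->
  exists (Q : afunctor (Mod R) Ab) (p : nattrans G Q), fp_functor Q /\ forall M,
    (forall v, exists w, app p M w = v) /\
    (forall v, app p M v = 0 <-> exists w, app f M w = v).
Proof.
move=> /fp_functorP[A [B [b [a [a_spans kera]]]]].
move=> /fp_functorP[A' [B' [b' [a' [a'_spans kera']]]]].
have [|Q [p pP]] :=
    @quotient_functor_exists (Mod R) G (fun M v => exists w, app f M w = v).
  split=> [M|M _ _ [v <-] [w <-]|M N h _ [w <-]].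
  - by exists 0; rewrite raddf0.
  - by exists (v - w); rewrite raddfB.
  - by exists (act F h w); rewrite act_app.
exists Q, p; split=> //; apply/fp_functorP.
have [phi phiE] := a'_spans A (app f A a).
have [l lE] := linear_pairing phi b'.
exists A', (A * B')%type, l, (app p A' a'); split=> [M v|M h].
  have [/(_ v)[w <-] _] := pP M; have [h <-] := a'_spans M w.
  by exists h; rewrite lact_app.
have [_ kerp] := pP M; rewrite lact_app kerp; split=> [[w]|[k kE]].
  have [g <-] := a_spans M w.
  rewrite -lact_app -phiE -(@lactM _ _ _ _ g phi (g \o phi)) // => /eqP.
  rewrite -subr_eq0 -(@lactB _ _ _ (g \o phi) h (g \o phi \- h)) //.
  move=> /eqP/kera'[k kE]; have [k' k'E] := linear_pair g (\- k).
  by exists k' => x; rewrite lE k'E /= -kE /= opprB addrC subrK.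
have [i iE] := linear_inl A B'; have [j jE] := linear_inr A B'.
exists (lact F (k \o i) a); rewrite -lact_app -phiE.
rewrite -(@lactM _ _ _ _ _ phi ((k \o i) \o phi)) //.
apply/eqP; rewrite -subr_eq0 -(@lactB _ _ _ _ _ ((k \o i) \o phi \- h)) //.
apply/eqP/kera'; exists (\- (k \o j)) => x.
rewrite /= kE lE iE jE -raddfB -raddfN; congr (k _).
by congr (_, _); rewrite /= ?subrr ?sub0r ?oppr0.
Qed.

(** With [f] lifted to [phi : A' -> A], let [P] be the pushout of [phi] and [b']
    and [Q] that of [A -> P] and [b].  An element [F h a] lies in the kernel
    when [h phi] factors through [b'], that is, when [h] extends to [P]; so the
    image of [a] in [F P] generates the kernel.  A map from [P] kills it
    when its restriction to [A] factors through [b], that is, when it extends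
    to [Q]. *)
Lemma fp_kernel F G (f : nattrans F G) : fp_functor F -> fp_functor G ->
  exists (K : afunctor (Mod R) Ab) (i : nattrans K F), fp_functor K /\ forall M,
    injective (app i M) /\
    (forall v, (exists w, app i M w = v) <-> app f M v = 0).
Proof.
move=> /fp_functorP[A [B [b [a [a_spans kera]]]]].
move=> /fp_functorP[A' [B' [b' [a' [a'_spans kera']]]]].
have [|K [i iP]] := @subfunctor_exists (Mod R) F (fun M v => app f M v = 0).
  split=> [M|M v w fv fw|M N h v fv]; first exact: raddf0.
    by rewrite raddfB fv fw subrr.
  by rewrite -act_app fv raddf0.
exists K, i; split=> //; apply/fp_functorP.
have [phi phiE] := a'_spans A (app f A a).
have [P [p [p_surj kerp]]] := pushout phi b'.
have [i1 i1E] := linear_inl A B'; have [i2 i2E] := linear_inr A B'.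
have [Q [q [q_surj kerq]]] := pushout (p \o i1) b.
have [j1 j1E] := linear_inl P B.
have [_ im] := iP P.
have [|c cE] := proj2 (im (lact F (p \o i1) a)).
  rewrite -lact_app -phiE -(@lactM _ _ _ _ _ phi ((p \o i1) \o phi)) //.
  apply/kera'; exists (p \o i2) => x /=; apply/eqP; rewrite -subr_eq0 -raddfB.
  rewrite i1E i2E; apply/eqP/kerp; exists x.
  by congr (_, _); rewrite ?subr0 ?sub0r.
exists P, Q, (q \o j1), c; split=> [M v|M g].
  have [i_inj imM] := iP M.
  have /imM : exists w, app i M w = app i M v by exists v.
  have [h hE] := a_spans M (app i M v).
  rewrite -hE -lact_app -phiE -(@lactM _ _ _ _ _ phi (h \o phi)) //.
  move=> /kera'[k kE].
  have [l lE] := linear_pair h k.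
  have [w /kerp[x ->]|g gE] := linear_factor (g := l) p_surj.
    by rewrite lE raddfN /= -kE subrr.
  exists g; apply: i_inj.
  rewrite -lact_app cE -hE -(@lactM _ _ _ _ _ _ (g \o (p \o i1))) //.
  congr (lact F _ a); apply: linear_ext => x.
  by rewrite /= gE i1E lE raddf0 addr0.
have [i_inj imM] := iP M.
have -> : lact K g c = 0 <-> lact F (g \o (p \o i1)) a = 0.
  rewrite (@lactM _ _ _ _ g (p \o i1)) // -cE lact_app.
  by split=> [->|]; rewrite ?raddf0 // -[RHS](raddf0 (app i M)) => /i_inj.
rewrite kera; split=> -[k kE].
  have [l lE] := linear_pair g k.
  have [w /kerq[x ->]|h hE] := linear_factor (g := l) q_surj.
    by rewrite lE raddfN /= -kE subrr.
  by exists h => x; rewrite /= hE j1E lE raddf0 addr0.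
have [j2 j2E] := linear_inr P B.
exists (k \o (q \o j2)) => x; rewrite /= kE /=.
apply/eqP; rewrite -subr_eq0 -!raddfB.
apply/eqP; rewrite -[RHS](raddf0 k); congr (k _); apply/kerq; exists x.
by rewrite j1E j2E; congr (_, _); rewrite ?subr0 ?sub0r.
Qed.

End Presentations.

(** * Tensor functors are injective among finitely presented functors *)

Section TensorExact.
Variable R : pzRingType.

(** Modulo the image of [M (x) A], the class of a pure tensor [m (x) y] depends
    only on [m] and [g y], which gives a map back from [M (x) C]. *)
Lemma tensor_exact (M : lmodType R^c) (A B C : lmodType R)
    (f : {linear A -> B}) (g : {linear B -> C}) :
  (forall z, exists y, g y = z) -> (forall y, g y = 0 -> exists x, f x = y) ->
  forall u : tensor M B, tmap idfun g u = 0 ->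
  exists v : tensor M A, tmap idfun f v = u.
Proof.
move=> g_surj kerg.
have [||Q [p [_ kerp]]] :=
    @zmod_quotient (tensor M B)
      (fun u => exists v : tensor M A, tmap idfun f v = u).
- by exists 0; rewrite raddf0.
- by move=> _ _ [v <-] [w <-]; exists (v - w); rewrite raddfB.
have E m y y' : g y = g y' -> p (pure m y) = p (pure m y').
  move=> yy'; apply/eqP; rewrite -subr_eq0 -raddfB; apply/eqP/kerp.
  have [|x fx] := kerg (y - y'); first by rewrite raddfB /= yy' subrr.
  exists (pure m x); rewrite tmapE fx.
  by apply: (addIr (pure m y')); rewrite -pureDr !subrK.
have [s sK] := choice g_surj.
have bal : balanced (fun m z => p (pure m (s z))).
  split=> [m m' z|m z z'|r m z].
  - by rewrite pureDl raddfD.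
  - by rewrite -raddfD -pureDr; apply: E; rewrite raddfD /= !sK.
  - by rewrite pure_bal; apply: E; rewrite linearZ /= !sK.
have lift_p : tlift bal \o tmap idfun g = p :> {additive tensor M B -> Q}.
  apply: tensor_ext => m y.
  by rewrite additive_compE tmapE tliftE; apply: E; rewrite sK.
by move=> u gu; apply/kerp; rewrite -lift_p additive_compE gu raddf0.
Qed.

(** With [f] lifted to [phi : A' -> A], an extension [s] of [t] is an element
    [u = s a'] of [M (x) A'] which [phi] maps to [t a] and [b'] maps to [0].
    The obstruction to solving this system is the image of [(t a, 0)] in
    [M (x) P], where [P] is the cokernel of [(phi, b') : A' -> A * B'].  It
    vanishes because [f] kills the image of [a] in [F P]: on [A'], the map
    [A -> P] agrees up to sign with a map through [b']. *)
Lemma nat_tensor_extend (M : lmodType R^c) (F G : afunctor (Mod R) Ab)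
    (f : nattrans F G) (t : nattrans F (tensor_functor M)) :
  fp_functor F -> fp_functor G ->
  (forall N v, app f N v = 0 -> app t N v = 0) ->
  exists s : nattrans G (tensor_functor M), comp_nat s f = t.
Proof.
move=> /fp_functorP[A [B [b [a [a_spans _]]]]].
move=> /fp_functorP[A' [B' [b' [a' pres']]]] kerf.
have [a'_spans kera'] := pres'.
have [phi phiE] := a'_spans A (app f A a).
have [P [p [p_surj kerp]]] := pushout phi (\- b').
have [i1 i1E] := linear_inl A B'; have [l lE] := linear_pairing phi b'.
have [u uE] : exists u : grp (tensor_functor M) A',
    lact (tensor_functor M) l u = lact (tensor_functor M) i1 (app t A a).
  apply: (tensor_exact p_surj) => [y /kerp[x ->]|].
    by exists x; rewrite lE; congr (_, _); rewrite /= opprK.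
  set u := lact _ i1 _; rewrite -[LHS]/(lact (tensor_functor M) p u) {}/u.
  rewrite -(@lactM _ _ _ _ _ p i1 (p \o i1)) // lact_app; apply: kerf.
  rewrite -lact_app -phiE -(@lactM _ _ _ _ _ _ phi ((p \o i1) \o phi)) //.
  have [i2 i2E] := linear_inr A B'.
  apply/kera'; exists (\- (p \o i2)) => x /=; apply/eqP.
  rewrite -addr_eq0 -raddfD i1E i2E; apply/eqP/kerp; exists x.
  by congr (_, _); rewrite /= ?addr0 ?add0r ?opprK.
have [pr1 pr1E] : exists h : {linear (A * B')%type -> A}, forall w, h w = w.1.
  by exists fst.
have [pr2 pr2E] : exists h : {linear (A * B')%type -> B'}, forall w, h w = w.2.
  by exists snd.
have phiu : lact (tensor_functor M) phi u = app t A a.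
  rewrite (@lactM _ _ _ _ _ pr1 l) => [|x]; last by rewrite lE pr1E.
  rewrite uE -(@lactM _ _ _ _ _ pr1 i1 idfun) ?lact1 // => x.
  by rewrite i1E pr1E.
have bu : lact (tensor_functor M) b' u = 0.
  rewrite (@lactM _ _ _ _ _ pr2 l) => [|x]; last by rewrite lE pr2E.
  rewrite uE -(@lactM _ _ _ _ _ pr2 i1 \0) => [|x].
    exact: (@act0 (Mod R)).
  by rewrite i1E pr2E.
have [s sE] := presents_nat pres' bu.
exists s; apply: (spans_nat_ext a_spans).
by rewrite app_comp -phiE -lact_app sE.
Qed.

End TensorExact.

(** * Modules of characters *)

Section FreeModules.
Variables (S : pzRingType) (N : lmodType S) (n : nat).

Lemma row_linear (h : {linear 'rV[S]_n -> N}) c :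
  h c = \sum_k c 0 k *: h (delta_mx 0 k).
Proof.
rewrite {1}[c]row_sum_delta raddf_sum.
by apply: eq_bigr => k _; rewrite /= linearZ_LR.
Qed.

Lemma row_lift (v : 'I_n -> N) :
  exists h : {linear 'rV[S]_n -> N}, forall k, h (delta_mx 0 k) = v k.
Proof.
have [c d|r c|h hE] := @make_linear S 'rV[S]_n N (fun c => \sum_k c 0 k *: v k).
- by rewrite -big_split; apply: eq_bigr => k _; rewrite mxE scalerDl.
- by rewrite scaler_sumr; apply: eq_bigr => k _; rewrite mxE scalerA.
exists h => k; rewrite hE (bigD1 k) //= mxE !eqxx scale1r big1 ?addr0 // => l.
by rewrite mxE eqxx eq_sym /= => /negPf ->; rewrite scale0r.
Qed.

Lemma row_ext (f g : {linear 'rV[S]_n -> N}) :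
  (forall k, f (delta_mx 0 k) = g (delta_mx 0 k)) -> f =1 g.
Proof.
move=> fg c; rewrite row_linear [RHS]row_linear.
by apply: eq_bigr => k _; rewrite fg.
Qed.

End FreeModules.

Section CharacterModule.
Variables (R : pzRingType) (I : Type) (M : I -> lmodType R^c).

(** The product over [i] of the left modules [Hom (M i, Q/Z)].  The product is
    part of the definition because [N (x) -] must be compared with the whole
    product at once. *)
Definition charmod : Type := forall i, {additive M i -> QZ}.

HB.instance Definition _ := gen_eqMixin charmod.
HB.instance Definition _ := gen_choiceMixin charmod.

Implicit Types x y z : charmod.

Definition charmod_add x y : charmod := fun i => x i \+ y i.
Definition charmod_zero : charmod := fun i => \0.
Definition charmod_opp x : charmod := fun i => \- x i.

Lemma charmod_ext x y : (forall i m, x i m = y i m) -> x = y.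
Proof.
move=> xy; apply: functional_extensionality_dep => i.
by apply: additive_ext => m; apply: xy.
Qed.

Lemma charmod_addA : associative charmod_add.
Proof. by move=> x y z; apply: charmod_ext => i m /=; rewrite addrA. Qed.

Lemma charmod_addC : commutative charmod_add.
Proof. by move=> x y; apply: charmod_ext => i m /=; rewrite addrC. Qed.

Lemma charmod_add0 : left_id charmod_zero charmod_add.
Proof. by move=> x; apply: charmod_ext => i m /=; rewrite add0r. Qed.

Lemma charmod_addN : left_inverse charmod_zero charmod_opp charmod_add.
Proof. by move=> x; apply: charmod_ext => i m /=; rewrite addNr. Qed.

HB.instance Definition _ := GRing.isZmodule.Build charmod
  charmod_addA charmod_addC charmod_add0 charmod_addN.

Definition charmod_scale (r : R) x : charmod :=
  fun i => x i \o ( *:%R (r : R^c) : {additive M i -> M i}).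

Lemma charmod_scaleA r s x :
  charmod_scale r (charmod_scale s x) = charmod_scale (r * s) x.
Proof. by apply: charmod_ext => i m /=; rewrite scalerA. Qed.

Lemma charmod_scale1 : left_id 1 charmod_scale.
Proof. by move=> x; apply: charmod_ext => i m /=; rewrite scale1r. Qed.

Lemma charmod_scaleDr : right_distributive charmod_scale +%R.
Proof. by move=> r x y; apply: charmod_ext. Qed.

Lemma charmod_scaleDl x : {morph charmod_scale^~ x : r s / r + s}.
Proof.
by move=> r s; apply: charmod_ext => i m /=; rewrite scalerDl raddfD.
Qed.

HB.instance Definition _ := GRing.Zmodule_isLmodule.Build R charmod
  charmod_scaleA charmod_scale1 charmod_scaleDr charmod_scaleDl.

Lemma charmod_balanced i :
  @balanced R (M i) charmod QZ (fun m x => x i m).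
Proof. by split=> // [m m' x]; rewrite raddfD. Qed.

Definition char_ev i : {additive tensor (M i) charmod -> QZ} :=
  tlift (charmod_balanced i).

Lemma char_evE i m x : char_ev i (pure m x) = x i m.
Proof. exact: tliftE. Qed.

End CharacterModule.
Arguments char_ev {R I M} i.

(** * Tensor products with a module of characters *)

Section FiniteFunctions.
Variables (V : zmodType) (n : nat).

Lemma ffun_single (k : 'I_n) :
  exists e : {additive V -> {ffun 'I_n -> V}},
    forall v, e v = [ffun l => if l == k then v else 0].
Proof.
apply: make_additive => v w; apply/ffunP => l; rewrite !ffunE.
by case: eqP => _; rewrite ?addr0.
Qed.

Lemma ffun_character (chi : {additive {ffun 'I_n -> V} -> QZ}) :
  exists x : 'I_n -> {additive V -> QZ},
    (forall k v, x k v = chi [ffun l => if l == k then v else 0]) /\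
    forall v, chi v = \sum_k x k (v k).
Proof.
have [e eE] := choice ffun_single.
exists (fun k => chi \o e k); split=> [k v|v]; first by rewrite /= eE.
have {1}-> : v = \sum_k e k (v k).
  apply/ffunP => l.
  rewrite sum_ffunE (bigD1 l) //= eE ffunE eqxx big1 ?addr0 // => k.
  by rewrite eE ffunE eq_sym => /negPf ->.
by rewrite raddf_sum.
Qed.

End FiniteFunctions.

Section PureTensors.
Variables (R : pzRingType) (N : lmodType R^c) (X : lmodType R).

Lemma pure0l (x : X) : pure (0 : N) x = 0.
Proof. by apply: (addIr (pure 0 x)); rewrite -pureDl !add0r. Qed.

Lemma pure0r (y : N) : pure y (0 : X) = 0.
Proof. by apply: (addIr (pure y 0)); rewrite -pureDr !add0r. Qed.

Lemma pure_suml (I : finType) (y : I -> N) (x : X) :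
  pure (\sum_i y i) x = \sum_i pure (y i) x.
Proof.
exact: (big_morph (fun y => pure y x) (fun y y' => pureDl y y' x) (pure0l x)).
Qed.

Lemma pure_sumr (I : finType) (y : N) (x : I -> X) :
  pure y (\sum_i x i) = \sum_i pure y (x i).
Proof. exact: (big_morph (pure y) (fun x x' => pureDr y x x') (pure0r y)). Qed.

Lemma tensor_gen n (p : {linear 'rV[R^c]_n -> N}) :
  (forall y, exists c, p c = y) ->
  forall u : tensor N X, exists x : 'I_n -> X,
    u = \sum_k pure (p (delta_mx 0 k)) (x k).
Proof.
move=> p_surj u; rewrite -(treprK u) tpiE.
elim: (trepr u) => [|[y x] s [x' IH]].
  by exists (fun=> 0); rewrite big_nil big1 // => k _; apply: pure0r.
have [c <-] := p_surj y; exists (fun k => (c 0 k : R) *: x + x' k).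
rewrite big_cons IH /= row_linear pure_suml -big_split.
by apply: eq_bigr => k _; rewrite pureDr -pure_bal.
Qed.

End PureTensors.

Section CharacterTensor.
Variables (R : pzRingType) (N : lmodType R^c) (n m : nat).
Variable p : {linear 'rV[R^c]_n -> N}.
Variable q : {linear 'rV[R^c]_m -> 'rV[R^c]_n}.
Hypothesis p_surj : forall y, exists c, p c = y.
Hypothesis kerp : forall c, p c = 0 <-> exists d, q d = c.

Notation "'e_ k" := (delta_mx 0 k) (at level 8, k at level 2, format "''e_' k").

(** The homomorphisms from [N] to [V] form the kernel of the map [V^n -> V^m]
    given by the matrix of [q]; a character of [V^n] that vanishes on this
    kernel extends along the map to a character of [V^m]. *)
Lemma character_relations (V : lmodType R^c) (x : 'I_n -> {additive V -> QZ}) :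
  (forall h : {linear N -> V}, \sum_k x k (h (p 'e_k)) = 0) ->
  exists z : 'I_m -> {additive V -> QZ},
    forall k v, x k v = \sum_j z j (q 'e_j 0 k *: v).
Proof.
move=> x0.
have [v w|f fE] := @make_additive {ffun 'I_n -> V} {ffun 'I_m -> V}
    (fun v => [ffun j => \sum_k q 'e_j 0 k *: v k]).
  apply/ffunP => j; rewrite !ffunE -big_split; apply: eq_bigr => k _.
  by rewrite ffunE scalerDr.
have [v w|chi chiE] :=
    @make_additive {ffun 'I_n -> V} QZ (fun v => \sum_k x k (v k)).
  by rewrite -big_split; apply: eq_bigr => k _; rewrite ffunE raddfD.
have [v fv|zeta zetaE] := character_extension (f := f) (chi := chi).
  have [h0 h0E] := row_lift (v : 'I_n -> V).
  have [c /kerp[d <-]|h hE] := linear_factor (g := h0) p_surj.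
    rewrite -[LHS]/((h0 \o q) d) row_linear big1 // => j _.
    rewrite -[RHS](scaler0 _ (d 0 j)); congr (_ *: _).
    have /ffunP/(_ j) := fv; rewrite fE !ffunE /= => fv0.
    rewrite (row_linear h0) -[RHS]fv0.
    by apply: eq_bigr => k _; rewrite h0E.
  rewrite chiE -[RHS](x0 h); apply: eq_bigr => k _.
  by rewrite hE h0E.
have [z [zE zetaz]] := ffun_character zeta.
exists z => k v; transitivity (chi [ffun l => if l == k then v else 0]).
  rewrite chiE (bigD1 k) //= ffunE eqxx big1 ?addr0 // => l /negPf lk.
  by rewrite ffunE lk raddf0.
rewrite -zetaE zetaz; apply: eq_bigr => j _; congr (z j _).
rewrite fE ffunE (bigD1 k) //= ffunE eqxx big1 ?addr0 // => l /negPf lk.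
by rewrite ffunE lk scaler0.
Qed.

(** [L] extends along the inclusion of the homomorphisms [N -> V] in [V^n]. *)
Lemma character_coordinates (V : lmodType R^c) (L : {linear N -> V} -> QZ) :
  (forall h h' : {linear N -> V}, L (h \+ h') = L h + L h') ->
  exists x : 'I_n -> {additive V -> QZ},
    forall h, L h = \sum_k x k (h (p 'e_k)).
Proof.
move=> LD.
have [//|L' L'E] := @make_additive (homgroup N V) QZ L.
have [h h'|f fE] := @make_additive (homgroup N V) {ffun 'I_n -> V}
    (fun h : {linear N -> V} => [ffun k => h (p 'e_k)]).
  by apply/ffunP => k; rewrite !ffunE.
have [h fh|chi chiE] := character_extension (f := f) (chi := L').
  suff -> : h = 0 by rewrite raddf0.
  apply: linear_ext => y; have [c <-] := p_surj y.
  rewrite -[RHS]/((\0 \o p) c) -[LHS]/(((h : {linear _ -> _}) \o p) c).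
  apply: row_ext => k /=; have /ffunP/(_ k) := fh.
  by rewrite fE !ffunE.
have [x [_ xE]] := ffun_character chi.
exists x => h; rewrite -L'E -chiE xE fE.
by apply: eq_bigr => k _; rewrite ffunE.
Qed.

Variables (I : Type) (M : I -> lmodType R^c).

Lemma char_ev_sum i (h : {linear N -> M i}) (x : 'I_n -> charmod M) :
  char_ev i (tmap h idfun (\sum_k pure (p 'e_k) (x k))) =
  \sum_k x k i (h (p 'e_k)).
Proof.
rewrite (raddf_sum (tmap h idfun)) (raddf_sum (char_ev i)).
by apply: eq_bigr => k _; rewrite tmapE char_evE.
Qed.

(** The presentation of [N] presents [N (x) charmod M] and copresents each
    [Hom (N, M i)].  Comparing the two through characters identifies
    [N (x) charmod M] with the product of the character groups of the
    [Hom (N, M i)]: this lemma gives injectivity and [char_ev_surj] gives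
    surjectivity. *)
Lemma char_ev_inj (u : tensor N (charmod M)) :
  (forall i (h : {linear N -> M i}), char_ev i (tmap h idfun u) = 0) -> u = 0.
Proof.
have [x ->] := tensor_gen p_surj u => x0.
have zP i : exists z : 'I_m -> {additive M i -> QZ},
    forall k v, x k i v = \sum_j z j (q 'e_j 0 k *: v).
  by apply: character_relations => h; rewrite -char_ev_sum.
have [z zE] := dep_choice zP.
have {zE}xE k : x k = \sum_j (q 'e_j 0 k : R) *: ((fun i => z i j) : charmod M).
  apply: charmod_ext => i v; rewrite zE.
  pose ev (y : charmod M) := y i v.
  rewrite -[RHS]/(ev _).
  by rewrite (@big_morph _ _ ev 0 +%R 0 +%R (fun _ _ => erefl) erefl).
under eq_bigr => k _ do rewrite xE pure_sumr.
rewrite exchange_big big1 // => j _.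
under eq_bigr => k _ do rewrite -pure_bal.
rewrite -pure_suml -row_linear.
suff -> : p (q 'e_j) = 0 by apply: pure0l.
by apply/kerp; exists 'e_j.
Qed.

Lemma char_ev_surj (L : forall i, {linear N -> M i} -> QZ) :
  (forall i (h h' : {linear N -> M i}), L i (h \+ h') = L i h + L i h') ->
  exists u : tensor N (charmod M),
    forall i (h : {linear N -> M i}), char_ev i (tmap h idfun u) = L i h.
Proof.
move=> LD; have [x xE] := dep_choice (fun i => character_coordinates (LD i)).
exists (\sum_k pure (p 'e_k) ((fun i => x i k) : charmod M)) => i h.
by rewrite char_ev_sum xE.
Qed.

End CharacterTensor.

(** * Tensor functors on finitely presented right modules *)

Section RightTensor.
Variable R : pzRingType.
Notation modR := (fp_right_mod R).
Implicit Types (E F G H : afunctor modR Ab) (X Y : lmodType R) (N : modR).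

Definition tens X : afunctor modR Ab.
Proof.
refine (@make_functor modR (fun N => tensor (sval N) X)
  (fun N N' (f : {linear sval N -> sval N'}) => tmap f idfun) _ _ _).
- by move=> N u; rewrite (additive_eq u (tmap1 (sval N) X)).
- by move=> N N' N'' g f u; apply: (additive_eq u (tmapMl X g f)).
- move=> N N' f g u.
  exact: (additive_eq u (tmapDl f g (idfun : {linear X -> X}))).
Defined.

Definition tens_map X Y (h : {linear X -> Y}) : nattrans (tens X) (tens Y).
Proof.
refine (@NatTrans modR Ab (tens X) (tens Y)
  (fun N => tmap idfun h :
     {additive tensor (sval N) X -> tensor (sval N) Y}) _).
by move=> N N' f; apply/esym/tmapC.
Defined.

Lemma tens_mapE X Y (h : {linear X -> Y}) N y x :
  app (tens_map h) N (pure y x) = pure y (h x).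
Proof. exact: tmapE. Qed.

Lemma tens_ext X (A : zmodType) N (f g : {additive grp (tens X) N -> A}) :
  (forall y x, f (pure y x) = g (pure y x)) -> forall u, f u = g u.
Proof.
by move=> fg u; apply: (additive_eq u (@tensor_ext _ _ _ A f g fg)).
Qed.

Lemma row1_fp : @finitely_presented R^c 'rV[R^c]_1.
Proof.
exists 1%N, 0%N, idfun, \0; split=> [y|x]; first by exists y.
by split=> [/= ->|[z <-] //]; exists 0.
Qed.

Definition row1 : modR := exist _ ('rV[R^c]_1 : lmodType R^c) row1_fp.
Definition unit1 : 'rV[R^c]_1 := delta_mx 0 0.

(** The isomorphism between [R (x) X] and [X], with the right module [R] taken
    as row vectors of length one. *)
Lemma tens_row1 X : exists rho : {additive grp (tens X) row1 -> X},
  (forall r x, rho (pure (r *: unit1) x) = (r : R) *: x) /\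
  (forall u, u = pure unit1 (rho u)).
Proof.
have bal : balanced (fun (c : 'rV[R^c]_1) (x : X) => (c 0 0 : R) *: x).
  split=> [c d y|c y z|r c y]; rewrite ?mxE ?scalerDl ?scalerDr //.
  by rewrite scalerA.
pose rho : {additive tensor 'rV[R^c]_1 X -> X} := tlift bal.
have rhoE c x : rho (pure c x) = (c 0 0 : R) *: x by apply: tliftE.
exists rho; split=> [r x|u].
  by rewrite [LHS]rhoE !mxE eqxx mulr1.
have [f fE] : exists f : {additive tensor 'rV[R^c]_1 X -> tensor 'rV[R^c]_1 X},
    forall v, f v = pure unit1 (rho v).
  by apply: make_additive => v w; rewrite raddfD pureDr.
rewrite -fE.
suff -> : f = idfun :> {additive tensor 'rV[R^c]_1 X -> _} by [].
apply: tensor_ext => c x; rewrite fE rhoE -pure_bal.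
by rewrite [c in RHS]row_sum_delta big_ord1.
Qed.

Lemma tens_faithful X Y (h h' : {linear X -> Y}) :
  tens_map h = tens_map h' -> h =1 h'.
Proof.
move=> hh' x; have [rho [rhoE _]] := tens_row1 Y.
have rho1 y : rho (pure unit1 y) = y by rewrite -[unit1]scale1r rhoE scale1r.
rewrite -[LHS]rho1 -[RHS]rho1.
by rewrite -(@tens_mapE _ _ h row1) -(@tens_mapE _ _ h' row1) hh'.
Qed.

(** The maps [R -> N] from the unit of the tensor product reach every element
    of [N], so the component of [t] at [R] determines [t]. *)
Lemma tens_full X Y (t : nattrans (tens X) (tens Y)) :
  exists h : {linear X -> Y}, t = tens_map h.
Proof.
have [rho [rhoE rhoK]] := tens_row1 Y.
have tE N (y : sval N) x :
    app t N (pure y x) = pure y (rho (app t row1 (pure unit1 x))).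
  have [f fE] := row_lift (fun _ : 'I_1 => y).
  have actf X' x' :
      act (tens X') (f : @hom modR row1 N) (pure unit1 x') = pure y x'.
    by rewrite -(fE 0); apply: tmapE.
  by rewrite -[in LHS]actf -act_app {1}[app t row1 _]rhoK actf.
have [x y|r x|h hE] :=
    @make_linear R X Y (fun x => rho (app t row1 (pure unit1 x))).
- by rewrite pureDr !raddfD.
- by rewrite -pure_bal tE rhoE.
exists h; apply: app_ext => N u; apply: tens_ext => y x.
by rewrite tE tens_mapE hE.
Qed.

End RightTensor.

(** * Injective copresentations *)

Section InjectiveTensors.
Variable R : pzRingType.
Notation modR := (fp_right_mod R).
Implicit Types (E F G H : afunctor modR Ab) (X Y : lmodType R) (N : modR).

(** Injectivity of the functor [- (x) X].  Stated for an arbitrary [i], with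
    the kernel of [i] contained in that of [a], it covers maps defined on the
    image of a transformation without a name for that image. *)
Definition tens_injective X : Prop :=
  forall G H (i : nattrans G H) (a : nattrans G (tens X)),
    (forall N g, app i N g = 0 -> app a N g = 0) ->
    exists b : nattrans H (tens X), comp_nat b i = a.

Section Characters.
Variables (I : Type) (M : I -> modR).
Let X : lmodType R := charmod (fun i => sval (M i)).

Definition tens_char i : {additive grp (tens X) (M i) -> QZ} := char_ev i.

Lemma tens_char_inj N (u v : grp (tens X) N) :
  (forall i (h : hom N (M i)),
     tens_char i (act (tens X) h u) = tens_char i (act (tens X) h v)) ->
  u = v.
Proof.
have [n [m [p [q [p_surj kerp]]]]] := svalP N.
move=> uv; apply/eqP; rewrite -subr_eq0; apply/eqP.
apply: (char_ev_inj p_surj kerp) => i h.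
rewrite -[LHS]/(tens_char i (act (tens X) (h : hom N (M i)) (u - v))).
by rewrite !raddfB uv subrr.
Qed.

(** Together with [tens_char_inj]: transformations [E -> tens X] are families
    of characters of the groups [E (M i)]. *)
Lemma characters_nat E (chi : forall i, {additive grp E (M i) -> QZ}) :
  exists t : nattrans E (tens X),
    forall i g, tens_char i (app t (M i) g) = chi i g.
Proof.
have ex N (g : grp E N) : exists u : grp (tens X) N,
    forall i (h : hom N (M i)),
      tens_char i (act (tens X) h u) = chi i (act E h g).
  have [n [m [p [q [p_surj kerp]]]]] := svalP N.
  apply: (@char_ev_surj R (sval N) n p p_surj I (fun i => sval (M i))
    (fun i (h : hom N (M i)) => chi i (act E h g))).
  move=> i h h'.
  apply: etrans (raddfD (chi i) _ _).
  exact: (congr1 (chi i) (@actD modR E N (M i) h h' g)).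
have tP N : exists t : {additive grp E N -> grp (tens X) N},
    forall g i (h : hom N (M i)),
      tens_char i (act (tens X) h (t g)) = chi i (act E h g).
  have [s sE] := choice (@ex N).
  have [g g'|t tE] := @make_additive _ _ s.
    by apply: tens_char_inj => i h; rewrite !raddfD !sE !raddfD.
  by exists t => g i h; rewrite tE sE.
have [t0 t0E] := dep_choice tP.
have [N N' f g|t tE] := @make_nat modR E (tens X) t0.
  by apply: tens_char_inj => i h; rewrite -actM !t0E actM.
by exists t => i g; rewrite tE -[t0 _ _]act1 t0E act1.
Qed.

(** The characters that define [a] extend along [i] one at a time. *)
Lemma charmod_tens_injective : tens_injective X.
Proof.
move=> G H i a kera.
have ex j : exists chi : {additive grp H (M j) -> QZ},
    forall g, chi (app i (M j) g) = tens_char j (app a (M j) g).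
  apply: (@character_extension _ _ (app i (M j)) (tens_char j \o app a (M j))).
  by move=> g /kera ag; apply: etrans (congr1 (tens_char j) ag) (raddf0 _).
have [chi chiE] := dep_choice ex.
have [b bE] := characters_nat chi.
exists b; apply: app_ext => N g; apply: tens_char_inj => j h.
by rewrite app_comp !act_app bE chiE.
Qed.

End Characters.

Definition rowmap : Type :=
  {nm : nat * nat & {linear 'rV[R^c]_nm.2 -> 'rV[R^c]_nm.1}}.

Definition presented_by (d : rowmap) N : Prop :=
  exists p : {linear 'rV[R^c]_(projT1 d).1 -> sval N},
    (forall y, exists c, p c = y) /\
    (forall c, p c = 0 <-> exists e, projT2 d e = c).

Lemma presented_by_retract d N N' : presented_by d N -> presented_by d N' ->
  exists (f : hom N N') (g : hom N' N), comp g f = idm N.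
Proof.
move=> [p [p_surj kerp]] [p' [p'_surj kerp']].
have [c /kerp/kerp' //|f fE] := linear_factor (g := p') p_surj.
have [c /kerp'/kerp //|g gE] := linear_factor (g := p) p'_surj.
exists f, g; apply: linear_ext => y; have [c <-] := p_surj y.
by rewrite -[LHS]/(g (f (p c))) fE gE.
Qed.

(** Finitely presented modules form a large type.  A product indexed by them
    would not be a module, whereas presentations form a small type. *)
Lemma fp_skeleton : exists D : rowmap -> modR, forall N,
  exists d (f : hom N (D d)) (g : hom (D d) N), comp g f = idm N.
Proof.
have ex d : exists N, (exists N', presented_by d N') -> presented_by d N.
  have [[N NP]|none] := pselect (exists N', presented_by d N').
    by exists N.
  by exists (row1 R).
have [D DP] := choice ex.
exists D => N; have [n [m [p [q pq]]]] := svalP N.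
pose d : rowmap := existT _ (n, m) q.
have dN : presented_by d N by exists p.
have DdP : presented_by d (D d) by apply: DP; exists N.
by exists d; apply: presented_by_retract dN DdP.
Qed.

(** The index set consists of all characters, on representatives of all
    finitely presented modules, that vanish on [P]. *)
Lemma subfunctor_is_kernel E (P : forall N, grp E N -> Prop) :
  is_subfunctor P ->
  exists X, tens_injective X /\
    exists t : nattrans E (tens X), forall N g, app t N g = 0 <-> P N g.
Proof.
move=> [P0 PB Pf]; have [D DP] := fp_skeleton.
pose I := {d : rowmap &
  {chi : {additive grp E (D d) -> QZ} | forall g, P _ g -> chi g = 0}}.
pose M (i : I) := D (projT1 i).
have [t tE] := @characters_nat I M E (fun i => sval (projT2 i)).
exists (charmod (fun i => sval (M i))); split.
  exact: charmod_tens_injective.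
exists t => N g; split=> [tg|Pg].
  apply: contrapT => Pg; have [d [f [f' f'f]]] := DP N.
  have Pfg : ~ P _ (act E f g).
    by move=> /(Pf _ _ f'); rewrite -actM f'f act1.
  have [chi [chiP]] := character_separation_subgroup (P0 _) (@PB _) Pfg.
  apply; pose i : I := existT _ d (exist _ chi chiP).
  by rewrite -[chi _](tE i) -act_app tg !raddf0.
apply: tens_char_inj => i h.
rewrite act_app tE !raddf0; apply: (svalP (projT2 i)); exact: Pf.
Qed.

Lemma injective_copresentation G :
  exists X Y (phi : {linear X -> Y}) (u : nattrans G (tens X)),
    [/\ tens_injective X, tens_injective Y, forall N, injective (app u N) &
      forall N v, app (tens_map phi) N v = 0 <-> exists g, app u N g = v].
Proof.
have [|X [injX [u uE]]] := @subfunctor_is_kernel G (fun N g => g = 0).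
  split=> [//|N v w -> ->|N N' f v ->]; [exact: subrr|exact: raddf0].
have [|Y [injY [t tE]]] :=
    @subfunctor_is_kernel (tens X) (fun N v => exists g, app u N g = v).
  split=> [N|N _ _ [v <-] [w <-]|N N' f _ [g <-]].
  - by exists 0; rewrite raddf0.
  - by exists (v - w); rewrite raddfB.
  - by exists (act G f g); rewrite act_app.
have [phi phiE] := tens_full t; rewrite {t}phiE in tE.
exists X, Y, phi, u; split=> // N g g' ug.
by apply/eqP; rewrite -subr_eq0; apply/eqP/uE; rewrite raddfB ug subrr.
Qed.

End InjectiveTensors.

(** * Universal arrows to the duality *)

Section Duality.
Variable R : pzRingType.
Notation modR := (fp_right_mod R).
Implicit Types (F : fp_functors R) (G : afunctor modR Ab).
Implicit Types (X Y : lmodType R) (N : modR).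

Lemma DA_actE F N N' (f : hom N N') (s : grp (DA_obj F) N) :
  smallnat_nat (act (DA_obj F) f s : smallnat F _) =
  comp_nat (tensor_nat f) (smallnat_nat (s : smallnat F _)).
Proof. by rewrite [LHS]natsmallK comp_natm1. Qed.

Lemma DA_etaE F F' (e : nattrans (sval F') (sval F)) N (s : grp (DA_obj F) N) :
  smallnat_nat (app (DA_eta e) N s : smallnat F' _) =
  comp_nat (smallnat_nat (s : smallnat F _)) e.
Proof. by rewrite [LHS]natsmallK comp_nat1m. Qed.

Lemma app_smallnatD F T (s t : smallnat F T) X (z : grp (sval F) X) :
  app (smallnat_nat (s + t)) X z =
  app (smallnat_nat s) X z + app (smallnat_nat t) X z.
Proof. by rewrite smallnat_natD. Qed.

Lemma DA_ev_exists F X (z : grp (sval F) X) :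
  exists t : nattrans (DA_obj F) (tens X), forall N s,
    app t N s = app (smallnat_nat (s : smallnat F _)) X z.
Proof.
have evP N : exists e : {additive grp (DA_obj F) N -> grp (tens X) N},
    forall s, e s = app (smallnat_nat (s : smallnat F _)) X z.
  apply: make_additive => s t.
  exact: (app_smallnatD (T := tensor_functor (sval N)) s t z).
have [e eE] := dep_choice evP.
have [N N' f s|t tE] := make_nat (a := e).
  by rewrite !eE DA_actE.
by exists t => N s; rewrite tE eE.
Qed.

Definition DA_ev F X (z : grp (sval F) X) : nattrans (DA_obj F) (tens X) :=
  projT1 (cid (DA_ev_exists z)).

Lemma DA_evE F X (z : grp (sval F) X) N (s : grp (DA_obj F) N) :
  app (DA_ev z) N s = app (smallnat_nat (s : smallnat F _)) X z.
Proof. by rewrite /DA_ev; case: cid. Qed.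

Lemma DA_ev_lact F X Y (h : {linear X -> Y}) (z : grp (sval F) X) :
  DA_ev (lact (sval F) h z) = comp_nat (tens_map h) (DA_ev z).
Proof. by apply: app_ext => N s; rewrite app_comp !DA_evE -lact_app. Qed.

Lemma DA_ev_app F F' (e : nattrans (sval F') (sval F)) X (z : grp (sval F') X) :
  DA_ev (app e X z) = comp_nat (DA_ev z) (DA_eta e).
Proof. by apply: app_ext => N s; rewrite app_comp !DA_evE DA_etaE. Qed.

Lemma DA_ev_inj F X (a : grp (sval F) X) N :
  spans a -> injective (app (DA_ev a) N).
Proof.
move=> a_spans s t; rewrite !DA_evE => st.
apply: (can_inj (@smallnatK R F _)).
exact: (@spans_nat_ext R _ (tensor_functor (sval N)) X a _ _ a_spans st).
Qed.

(** With [DA_ev_inj]: a presentation of [F] identifies [D_A F] with the kernel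
    of [- (x) X -> - (x) Y]. *)
Lemma DA_ev_image F X Y (b : {linear X -> Y}) (a : grp (sval F) X) N
    (u : grp (tens X) N) :
  presents b a ->
  (exists s, app (DA_ev a) N s = u) <-> app (tens_map b) N u = 0.
Proof.
move=> ab; split=> [[s <-]|bu].
  by rewrite -app_comp -DA_ev_lact (presents0 ab) DA_evE raddf0.
have [t tE] := @presents_nat _ _ (tensor_functor (sval N)) _ _ _ _
  (u : grp (tensor_functor (sval N)) X) ab bu.
by exists (natsmall t); rewrite DA_evE natsmallK tE.
Qed.

(** If [z] is [F h a] for the generator [a] with relations [b], then
    [- (x) h] vanishes on the kernel of [- (x) b], so by injectivity it factors
    through [- (x) b], that is, [h] factors through [b]. *)
Lemma DA_ev_separates F X (z : grp (sval F) X) : tens_injective X ->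
  (forall N s, app (DA_ev z) N s = 0) -> z = 0.
Proof.
move=> injX z0.
have [A [B [b [a ab]]]] := proj1 (fp_functorP _) (svalP F).
have [a_spans kera] := ab; have [h hz] := a_spans X z.
have [N v bv|k kE] := @injX (tens A) (tens B) (tens_map b) (tens_map h).
  have [s <-] := proj2 (DA_ev_image v ab) bv.
  by rewrite -app_comp -DA_ev_lact hz z0.
have [k' k'E] := tens_full k; rewrite {k}k'E in kE.
rewrite -hz; apply/kera; exists k' => x.
have /(tens_faithful (h' := k' \o b)) -> // : tens_map h = tens_map (k' \o b).
apply: app_ext => N u; rewrite -kE; apply: esym.
exact: (additive_eq u (tmapMr (sval N) k' b)).
Qed.

(** A map defined on [D_A F], as a subfunctor of some [- (x) A], extends to
    [- (x) A], where it comes from a linear map. *)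
Lemma DA_ev_represents F X (t : nattrans (DA_obj F) (tens X)) :
  tens_injective X ->
  exists z : grp (sval F) X, DA_ev z = t.
Proof.
move=> injX.
have [A [B [b [a [a_spans kera]]]]] := proj1 (fp_functorP _) (svalP F).
have [N s as0|k kE] := @injX (DA_obj F) (tens A) (DA_ev a) t.
  have -> : s = 0 by apply: (DA_ev_inj a_spans); rewrite as0 raddf0.
  exact: raddf0.
have [h hE] := tens_full k; exists (lact (sval F) h a).
by rewrite DA_ev_lact -hE.
Qed.

(** For a copresentation [phi : X -> Y] of [G] and the functor [S] presented by
    [phi], both [G] and [D_A S] are the kernel of [- (x) phi].  A map
    [D_A F -> G] is a map to [- (x) X] killed by [- (x) phi], that is, an
    element of [F X] killed by [F phi], that is, a map [S -> F]. *)
Lemma DA_universal_arrow G :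
  exists (S : fp_functors R) (eta : nattrans (DA_obj S) G),
    @is_iso (functors modR Ab) (DA_obj S) G eta /\
    forall F (g : nattrans (DA_obj F) G),
      exists! f : nattrans (sval S) (sval F), comp_nat eta (DA_eta f) = g.
Proof.
have [X [Y [phi [u [injX injY u_inj im_u]]]]] := injective_copresentation G.
have [S0 [x0 x0P]] := presented_functor_exists phi.
have S0_fp : fp_functor S0 by apply/fp_functorP; exists X, Y, phi, x0.
pose S : fp_functors R := exist _ S0 S0_fp.
have x0_spans : @spans R (sval S) X x0 := proj1 x0P.
have [N s|eta etaE] := nat_lift (g := @DA_ev S X x0) u_inj.
  by apply/im_u/(@DA_ev_image S _ _ _ _ _ _ x0P); exists s.
exists S, eta; split.
  apply/nat_iso; split=> N.
    by move=> s t st; apply: (DA_ev_inj x0_spans); rewrite -etaE !app_comp st.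
  move=> v; have uv : exists g, app u N g = app u N v by exists v.
  have [s sE] := proj2 (@DA_ev_image S _ _ _ _ _ _ x0P) (proj2 (im_u _ _) uv).
  by exists s; apply: u_inj; rewrite -app_comp etaE.
move=> F g; have [z zE] := DA_ev_represents (comp_nat u g) injX.
have phiz : lact (sval F) phi z = 0.
  apply: (DA_ev_separates injY) => N s; rewrite DA_ev_lact zE.
  by apply/im_u; exists (app g N s).
have key f : comp_nat eta (DA_eta f) = g <-> @app _ S0 (sval F) f X x0 = z.
  split=> [fg|fz]; last first.
    apply: app_ext => N s; apply: u_inj; rewrite -app_comp comp_natA etaE.
    by rewrite -DA_ev_app fz zE.
  apply/eqP; rewrite -subr_eq0; apply/eqP/(DA_ev_separates injX) => N s.
  have -> : app (DA_ev (app f X x0 - z)) N s =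
      app (DA_ev (app f X x0)) N s - app (DA_ev z) N s.
    by rewrite !DA_evE raddfB.
  by rewrite zE -fg DA_ev_app comp_natA etaE subrr.
have [f fz] := presents_nat x0P phiz.
exists f; split; first exact/key.
by move=> f' /key f'z; apply: (spans_nat_ext (proj1 x0P)); rewrite fz f'z.
Qed.

End Duality.

(** * The maps inverted by the duality *)

Section SerreIso.
Variable R : pzRingType.
Notation modR := (fp_right_mod R).
Implicit Types (F : fp_functors R) (N : modR).
Notation tensl N := (tensor_functor (sval N)).

Lemma DA_zeroP F : is_zero_object (DA R F) <->
  forall N (s : nattrans (sval F) (tensl N)), s = zero_nat (sval F) (tensl N).
Proof.
split=> [[F0 _] N s|F0].
  have id0 := F0 _ (id_nat (DA_obj F)) (zero_nat (DA_obj F) (DA_obj F)).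
  have s0 : natsmall s = 0.
    exact: (congr1 (fun c : nattrans (DA_obj F) (DA_obj F) =>
      app c N (natsmall s)) id0).
  rewrite -[s]natsmallK s0.
  apply: (can_inj (@natsmallK R F (tensl N))); rewrite smallnatK.
  by apply: val_inj.
have s0 N (s : grp (DA_obj F) N) : s = 0.
  rewrite -[s](@smallnatK R F (tensl N)) (F0 N (smallnat_nat _)).
  by apply: val_inj.
split=> G f g; apply: app_ext => N s.
  by apply: etrans (s0 N _) (esym (s0 N _)).
by rewrite (s0 N s) !raddf0.
Qed.

Lemma DA_isoP F F' (f : hom F F') : is_iso (fmap (DA R) f) <->
  (forall N (s t : nattrans (sval F') (tensl N)),
     comp_nat s f = comp_nat t f -> s = t) /\
  (forall N (t : nattrans (sval F) (tensl N)),
     exists s : nattrans (sval F') (tensl N), comp_nat s f = t).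
Proof.
have isoE : is_iso (fmap (DA R) f) <->
    @is_iso (functors modR Ab) _ _ (DA_eta f).
  by split=> -[g [gf fg]]; exists g.
have etaE N (s : nattrans (sval F') (tensl N)) :
    app (DA_eta f) N (natsmall s) = natsmall (comp_nat s f).
  by apply: (can_inj (@smallnatK R F (tensl N))); rewrite DA_etaE !natsmallK.
rewrite isoE nat_iso; split=> [[f_inj f_surj]|[f_inj f_surj]]; split=> N.
- move=> s t st; apply: (can_inj (@natsmallK R F' (tensl N))).
  by apply: f_inj; rewrite !etaE st.
- move=> t; have [s st] := f_surj N (natsmall t).
  exists (smallnat_nat (s : smallnat F' (tensl N))).
  apply: (can_inj (@natsmallK R F (tensl N))).
  by rewrite -etaE smallnatK.
- move=> s t st; apply: (can_inj (@smallnatK R F' (tensl N))); apply: f_inj.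
  by rewrite -!DA_etaE st.
- move=> v; have [s sf] := f_surj N (smallnat_nat (v : smallnat F (tensl N))).
  by exists (natsmall s); rewrite etaE sf; apply: smallnatK.
Qed.

(** Injectivity of [s |-> s f]: if [s f = 0] then [s] factors through the
    cokernel of [f].  Surjectivity: a transformation [t] that vanishes on the
    kernel of [f] extends along [f], and vanishing on the kernel of [f] in the
    category [fp_functors R] suffices because elements of the pointwise kernel
    are maps from representable functors. *)
Lemma serre_iso_DA_iso F F' (f : hom F F') :
  serre_iso (fun F : fp_functors R => is_zero_object (DA R F)) f ->
  is_iso (fmap (DA R) f).
Proof.
move=> [[k [j [[fj j_univ] k0]]] [c [q [[qf q_univ] c0]]]].
have [Q [p [Q_fp /all_and2[p_surj kerp]]]] :=
  fp_cokernel f (svalP F) (svalP F').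
have pf : comp_nat p f = zero_nat (sval F) Q.
  by apply: app_ext => M v; rewrite app_comp; apply/kerp; exists v.
apply/DA_isoP; split.
- move=> N s t st; pose d := add_nat s (opp_nat t).
  have dE M v : app d M v = app s M v - app t M v by [].
  have [M v /kerp[w <-]|h hE] := nat_factor (g := d) p_surj.
    by rewrite dE -!app_comp st subrr.
  have [h' [h'E _]] := q_univ (exist _ Q Q_fp) p pf.
  have hh'0 : comp_nat h h' = zero_nat (sval c) (tensl N).
    by have /DA_zeroP := c0; apply.
  have d0 : d = zero_nat _ _.
    rewrite -hE -h'E -[LHS]/(comp_nat h (comp_nat h' q)) comp_natA hh'0.
    by apply: app_ext.
  apply: app_ext => M v; apply/eqP; rewrite -subr_eq0 -dE d0.
  exact/eqP.
- move=> N t; apply: nat_tensor_extend; [exact: svalP|exact: svalP|] => M v fv.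
  have [y yv] := yoneda_map v.
  have M_fp : fp_functor (representable M) by apply: representable_fp.
  have fy : comp_nat f y = zero_nat (representable M) (sval F').
    by apply: app_ext => L h; rewrite app_comp yv -lact_app fv raddf0.
  have [h [hE _]] := j_univ (exist _ (representable M) M_fp) y fy.
  have tj0 : comp_nat t j = zero_nat (sval k) (tensl N).
    by have /DA_zeroP := k0; apply.
  rewrite -[v](@lact1 R) -yv -hE.
  by rewrite -[LHS]/(app (comp_nat t j) M (app h M idfun)) tj0.
Qed.

(** A transformation [s] from the kernel of [f] extends to the source of [f],
    and the extension factors through [f], so that [s = 0].  A transformation
    from the cokernel of [f] is determined by its restriction to the target of
    [f], which dies on composition with [f]. *)
Lemma DA_iso_serre_iso F F' (f : hom F F') :
  is_iso (fmap (DA R) f) ->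
  serre_iso (fun F : fp_functors R => is_zero_object (DA R F)) f.
Proof.
move=> /DA_isoP[f_inj f_surj].
have [Q [p [Q_fp /all_and2[p_surj kerp]]]] :=
  fp_cokernel f (svalP F) (svalP F').
have [K [i [K_fp /all_and2[i_inj im_i]]]] := fp_kernel f (svalP F) (svalP F').
have pf : comp_nat p f = zero_nat (sval F) Q.
  by apply: app_ext => M v; rewrite app_comp; apply/kerp; exists v.
have fi : comp_nat f i = zero_nat K (sval F').
  by apply: app_ext => M v; rewrite app_comp; apply/im_i; exists v.
split.
- exists (exist _ K K_fp), i; split.
    split=> // w g fg.
    have [M v|h hE] := nat_lift (g := g) i_inj.
      apply/im_i.
      exact: (congr1 (fun c : nattrans (sval w) (sval F') => app c M v) fg).
    exists h; split=> // h' h'E; apply: app_ext => M v; apply: i_inj.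
    by rewrite -!app_comp hE; congr (app _ M v); apply: esym.
  apply/DA_zeroP => N s.
  have [M v iv|s' s'E] :=
      @nat_tensor_extend R (sval N) K (sval F) i s K_fp (svalP F).
    have -> : v = 0 by apply: i_inj; rewrite iv raddf0.
    exact: raddf0.
  have [s'' s''E] := f_surj N s'.
  rewrite -s'E -s''E -comp_natA fi.
  by apply: app_ext => M v; rewrite app_comp raddf0.
exists (exist _ Q Q_fp), p; split.
  split=> // w g gf.
  have [M _ /kerp[v <-]|h hE] := nat_factor (g := g) p_surj.
    exact: (congr1 (fun c : nattrans (sval F) (sval w) => app c M v) gf).
  exists h; split=> // h' h'E; apply: app_ext => M v.
  have [v' <-] := p_surj M v.
  by rewrite -!app_comp hE; congr (app _ M v'); apply: esym.
apply/DA_zeroP => N s.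
have sp : comp_nat s p = zero_nat (sval F') (tensl N).
  apply: f_inj; rewrite -comp_natA pf.
  by apply: app_ext => M v; rewrite app_comp raddf0.
apply: app_ext => M v; have [w <-] := p_surj M v.
by rewrite -app_comp sp.
Qed.

End SerreIso.

(** * Localizations from universal arrows *)

Lemma iso_epi (C : category) (x y z : C) (e : hom x y) (f g : hom y z) :
  is_iso e -> comp f e = comp g e -> f = g.
Proof.
by move=> [i [_ ei]] fg; rewrite -[f]compm1 -[g]compm1 -ei !compA fg.
Qed.

Section LocalizationFunctor.
Variables (C D : category) (W : forall x y : C, hom x y -> Prop).
Variable T : functor C D.
Notation CW := (localization W).
Notation lcmp := (@comp CW _ _ _).
Hypothesis TW : forall x y (f : hom x y), W f -> is_iso (fmap T f).

Definition inverse x y (s : hom x y) (Ws : W s) : hom (T y) (T x) :=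
  projT1 (cid (TW Ws)).

Fixpoint lterm_map x y (t : lterm W x y) : hom (T x) (T y) :=
  match t with
  | LGen _ _ f => fmap T f
  | LInv _ _ _ Ws => inverse Ws
  | LComp _ _ _ g f => comp (lterm_map g) (lterm_map f)
  end.

Lemma lterm_map_eq x y (t t' : lterm W x y) :
  lterm_eq t t' -> lterm_map t = lterm_map t'.
Proof.
elim=> //= {x y t t'}.
- by move=> x y f g h _ -> _.
- by move=> x y z g g' f f' _ -> _ ->.
- by move=> x y f; rewrite fmap1 comp1m.
- by move=> x y f; rewrite fmap1 compm1.
- by move=> w x y z h g f; rewrite compA.
- by move=> x y z g f; rewrite fmapM.
- by move=> x y s Ws; rewrite fmap1 /inverse; case: cid => /= i [].
- by move=> x y s Ws; rewrite fmap1 /inverse; case: cid => /= i [].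
Qed.

Definition localization_functor : functor CW D.
Proof.
refine (@Functor CW D T
  (fun x y (f : lhom W x y) => lterm_map (lrepr f)) _ _).
- by move=> x; rewrite (lterm_map_eq (lrepr_class _)) /= fmap1.
- by move=> x y z g f; rewrite (lterm_map_eq (lrepr_class _)).
Defined.

Lemma lclass_comp x y z (g : lterm W y z) (f : lterm W x y) :
  lcmp (lclass g) (lclass f) = lclass (LComp g f).
Proof. by apply/lclassE; apply: leqt_comp; apply: lrepr_class. Qed.

Lemma localization_functorE x y (t : lterm W x y) :
  fmap localization_functor (lclass t : @hom CW x y) = lterm_map t.
Proof. exact: lterm_map_eq (lrepr_class t). Qed.

Let gen (x y : C) (f : hom x y) : @hom CW x y := lclass (LGen W f).

Lemma gen_comp (x y z : C) (g : hom y z) (f : hom x y) :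
  lcmp (gen g) (gen f) = gen (comp g f).
Proof. by rewrite lclass_comp; apply/lclassE/leqt_sym/leqt_gen. Qed.

Hypothesis WT : forall x y (f : hom x y), is_iso (fmap T f) -> W f.
Hypothesis arrow : forall d : D, exists (c : C) (eta : hom d (T c)),
  is_iso eta /\
  forall x (g : hom d (T x)), exists! f : hom c x, comp (fmap T f) eta = g.

Lemma lclass_inv_gen x y (s : hom x y) (Ws : W s) :
  lcmp (lclass (LInv Ws)) (gen s) = @idm CW x.
Proof. by rewrite lclass_comp; apply/lclassE/leqt_Vm. Qed.

Lemma lclass_gen_inv x y (s : hom x y) (Ws : W s) :
  lcmp (gen s) (lclass (LInv Ws)) = @idm CW y.
Proof. by rewrite lclass_comp; apply/lclassE/leqt_mV. Qed.

Section Equivalence.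
Variables (S : D -> C) (eta : forall d, hom d (T (S d))).
Hypothesis eta_iso : forall d, is_iso (eta d).
Hypothesis etaP : forall d x (g : hom d (T x)),
  exists! f : hom (S d) x, comp (fmap T f) (eta d) = g.

Let adj d x (g : hom d (T x)) : hom (S d) x := projT1 (cid (etaP g)).

Lemma adjE d x (g : hom d (T x)) : comp (fmap T (adj g)) (eta d) = g.
Proof. by rewrite /adj; case: cid => f []. Qed.

Lemma adj_uniq d x (f f' : hom (S d) x) :
  comp (fmap T f) (eta d) = comp (fmap T f') (eta d) -> f = f'.
Proof.
have [h [_ h_uniq]] := etaP (comp (fmap T f') (eta d)).
by move=> ff'; rewrite -(h_uniq f ff') -(h_uniq f' erefl).
Qed.

Let Smap d d' (g : hom d d') : hom (S d) (S d') := adj (comp (eta d') g).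

Lemma Smap1 d : Smap (idm d) = idm (S d).
Proof. by apply: adj_uniq; rewrite adjE fmap1 comp1m compm1. Qed.

Lemma SmapM d d' d'' (g' : hom d' d'') (g : hom d d') :
  Smap (comp g' g) = comp (Smap g') (Smap g).
Proof. by apply: adj_uniq; rewrite adjE fmapM -compA adjE !compA adjE. Qed.

Definition section_functor : functor D CW.
Proof.
refine (@Functor D CW S (fun d d' g => gen (Smap g)) _ _).
- by move=> d; rewrite Smap1.
- by move=> d d' d'' g' g; rewrite SmapM -gen_comp.
Defined.

Let eps x : hom (S (T x)) x := adj (idm (T x)).

Lemma eps_inverted x : W (eps x).
Proof.
apply: WT; exists (eta (T x)).
have epsE : comp (fmap T (eps x)) (eta (T x)) = idm (T x) by apply: adjE.
split=> //; apply: (iso_epi (eta_iso (T x))).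
by rewrite -compA epsE comp1m compm1.
Qed.

Lemma eps_natural_gen x y (f : hom x y) :
  comp f (eps x) = comp (eps y) (Smap (fmap T f)).
Proof.
by apply: adj_uniq; rewrite !fmapM -!compA !adjE compm1 compA adjE comp1m.
Qed.

(** Naturality passes from maps of [C] to all maps of the localization because
    a formal inverse commutes with what the map it inverts commutes with. *)
Lemma eps_natural x y (t : lterm W x y) :
  lcmp (lclass t) (gen (eps x)) =
  lcmp (gen (eps y)) (gen (Smap (lterm_map t))).
Proof.
elim: t => {x y} [x y f|x y s Ws|x y z g IHg f IHf].
- rewrite [lterm_map _]/= -[lclass (LGen W f)]/(gen f).
  by rewrite !gen_comp eps_natural_gen.
- rewrite [lterm_map _]/=; have inv : comp (fmap T s) (inverse Ws) = idm (T y).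
    by rewrite /inverse; case: cid => i [].
  have -> : gen (eps y) = lcmp (gen s)
      (lcmp (gen (eps x)) (gen (Smap (inverse Ws)))).
    by rewrite !gen_comp compA eps_natural_gen -compA -SmapM inv Smap1 compm1.
  by rewrite (@compA CW) lclass_inv_gen (@comp1m CW).
- rewrite [lterm_map _]/= -lclass_comp -(@compA CW) IHf (@compA CW) IHg.
  by rewrite -(@compA CW) gen_comp SmapM.
Qed.

Lemma section_equivalence : equivalent CW D.
Proof.
exists localization_functor, section_functor; split.
  have nat x y (f : @hom CW x y) :
      lcmp f (gen (eps x)) =
      lcmp (gen (eps y))
        (fmap section_functor (fmap localization_functor f)).
    by rewrite -{1}[f]lreprK eps_natural.
  exists (@NatTrans CW CW
    (comp_functor section_functor localization_functor) (id_functor _)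
    (fun x => gen (eps x)) nat) => x.
  exists (lclass (LInv (eps_inverted x))); split.
    exact: lclass_inv_gen.
  exact: lclass_gen_inv.
have [i /all_and2[iK Ki]] := dep_choice eta_iso.
have nat d d' (g : hom d d') : comp g (i d) =
    comp (i d') (fmap localization_functor (fmap section_functor g)).
  rewrite localization_functorE /=; apply: (iso_epi (eta_iso d)).
  by rewrite -!compA adjE iK compm1 compA iK comp1m.
exists (@NatTrans D D (comp_functor localization_functor section_functor)
  (id_functor D) i nat) => d.
by exists (eta d); split; [apply: Ki|apply: iK].
Qed.

End Equivalence.

(** The left adjoint [S] of [T] given by the universal arrows satisfies
    [T S = 1] up to the isomorphism [eta], and the counit [S T -> 1] consists of
    maps in [W], which become invertible in the localization. *)
Theorem localization_equivalent : equivalent (localization W) D.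
Proof.
have ex d : exists s : {c : C & hom d (T c)},
    is_iso (projT2 s) /\ forall x (g : hom d (T x)),
      exists! f : hom (projT1 s) x, comp (fmap T f) (projT2 s) = g.
  by have [c [e P]] := arrow d; exists (existT _ c e).
have [s sP] := dep_choice ex.
apply: (@section_equivalence (fun d => projT1 (s d)) (fun d => projT2 (s d))).
- by move=> d; have [] := sP d.
- by move=> d; have [_] := sP d.
Qed.

End LocalizationFunctor.

(** * The Serre quotient *)

Theorem corollary5p2 (R : pzRingType) :
  equivalent
    (serre_quotient (fun F : fp_functors R => is_zero_object (DA R F)))
    (op (functors (fp_right_mod R) Ab)).
Proof.
apply: (localization_equivalent (T := DA R)) => [F F' f|F F' f|G].
- exact: serre_iso_DA_iso.
- exact: DA_iso_serre_iso.
have [S [eta [[i [i_eta eta_i]] univ]]] := DA_universal_arrow G.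
exists S, eta; split; first by exists i.
by move=> F g; apply: univ.
Qed.
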